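(* Let $r\ge 3$ be a fixed integer, and let $p=p(n)\in[0,1]$ be such that $p\,n^{r/2}\to\infty$ as $n\to\infty$. Then, with high probability over $T\sim\mathcal H_r(n,p)$, $$\|T\|_{\mathrm{inj}}-\|T-\mathbb E T\|_{\mathrm{inj}}=(1-o(1))\,p\,n^{r/2}\qquad\text{as } n\to\infty .$$ That is, for every $\delta>0$, $$\Pr_{T\sim\mathcal H_r(n,p)}\Big(\big|\,\|T\|_{\mathrm{inj}}-\|T-\mathbb E T\|_{\mathrm{inj}}-p\,n^{r/2}\,\big|\le\delta\,p\,n^{r/2}\Big)\longrightarrow 1\quad\text{as } n\to\infty .$$
   Context: Write $[n]=\{1,\dots,n\}$. The Erdős–Rényi model of $r$-uniform hypergraphs on $[n]$ with parameter $p$ includes each subset $e\subseteq[n]$ with $|e|=r$ as a hyperedge independently with probability $p$. The adjacency tensor $T\in(\mathbb R^n)^{\otimes r}$ of a hypergraph is defined by $T_{i_1,\dots,i_r}=1$ if $\{i_1,\dots,i_r\}$ is a hyperedge (in particular $i_1,\dots,i_r$ are distinct), and $T_{i_1,\dots,i_r}=0$ otherwise. $\mathcal H_r(n,p)$ denotes the distribution of the adjacency tensor of the Erdős–Rényi hypergraph. $\mathbb E T$ is the entrywise expectation. The injective norm of $T\in(\mathbb R^n)^{\otimes r}$ is $\|T\|_{\mathrm{inj}}=\max\{|\langle T,x_1\otimes\cdots\otimes x_r\rangle| : x_1,\dots,x_r\in\mathbb R^n,\ \|x_1\|_2=\dots=\|x_r\|_2=1\}$, where $\langle T,X\rangle=\sum_{i\in[n]^r}T_iX_i$.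 *)

(* Defs.v *)
From HB Require Import structures.
From mathcomp Require Import all_boot all_order all_algebra.
From mathcomp Require Import all_classical all_reals all_analysis.

Set Implicit Arguments.
Unset Strict Implicit.
Unset Printing Implicit Defensive.

Import Order.TTheory GRing.Theory Num.Theory.
Import numFieldNormedType.Exports.

Local Open Scope ring_scope.

(* (R^n)^{\otimes r}, with multi-indices in [n]^r given as r-tuples. *)
Notation tensor R r n := {ffun r.-tuple 'I_n -> R}.

Definition tensor_inner (R : realType) (r n : nat) (T X : tensor R r n) : R :=
  \sum_(i : r.-tuple 'I_n) T i * X i.

Definition rank_one (R : realType) (r n : nat) (x : 'I_r -> 'rV[R]_n) :
    tensor R r n :=
  [ffun i : r.-tuple 'I_n => \prod_(j < r) x j ord0 (tnth i j)].

(* The library norm on row vectors is the sup norm, hence this definition. *)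
Definition l2norm (R : realType) (n : nat) (x : 'rV[R]_n) : R :=
  Num.sqrt (\sum_(k < n) x ord0 k ^+ 2).

(* For 0 < n the set is nonempty and compact, so the supremum is a maximum;
   for n = 0 < r it is empty and the value is 0. *)
Definition inj_norm (R : realType) (r n : nat) (T : tensor R r n) : R :=
  sup [set y : R | exists x : 'I_r -> 'rV[R]_n,
         (forall j, l2norm (x j) = 1) /\
         y = `|tensor_inner T (rank_one x)| ]%classic.

Definition hyperedges (r n : nat) : {set {set 'I_n}} :=
  [set e : {set 'I_n} | #|e| == r]%SET.

(* r-uniform hypergraphs on [n], identified with their hyperedge sets. *)
Definition hypergraphs (r n : nat) : {set {set {set 'I_n}}} :=
  powerset (hyperedges r n).

(* The probability of the hypergraph H when every r-subset is a hyperedge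
   independently with probability p. *)
Definition ER_weight (R : realType) (r n : nat) (p : R)
    (H : {set {set 'I_n}}) : R :=
  \prod_(e in hyperedges r n) (if e \in H then p else 1 - p).

Definition ER_expect (R : realType) (r n : nat) (p : R)
    (f : {set {set 'I_n}} -> R) : R :=
  \sum_(H in hypergraphs r n) ER_weight r p H * f H.

(* A tuple with repeated entries has fewer than r distinct ones, so for an
   r-uniform H its coefficient is 0. *)
Definition adj_tensor (R : realType) (r n : nat) (H : {set {set 'I_n}}) :
    tensor R r n :=
  [ffun i : r.-tuple 'I_n => (([set k in i]%SET \in H)%:R : R)].

(* P(T \in A) for T distributed according to H_r(n, p). *)
Definition ER_prob (R : realType) (r n : nat) (p : R)
    (A : pred (tensor R r n)) : R :=
  \sum_(H in hypergraphs r n | A (adj_tensor R r H)) ER_weight r p H.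

Definition mean_tensor (R : realType) (r n : nat) (p : R) : tensor R r n :=
  [ffun i : r.-tuple 'I_n =>
     ER_expect r p (fun H : {set {set 'I_n}} => adj_tensor R r H i)].

(* Main.v *)
Require Import Defs.
From HB Require Import structures.
From mathcomp Require Import all_boot all_order all_algebra.
From mathcomp Require Import all_classical all_reals all_analysis.
From mathcomp Require Import ring lra.

Set Implicit Arguments.
Unset Strict Implicit.
Unset Printing Implicit Defensive.

Import Order.TTheory GRing.Theory Num.Theory.
Import numFieldNormedType.Exports.

Local Open Scope ring_scope.

(** Write q = p n^(r/2) and s = sqrt n, so that q = p s^r. Since
    q (1 - r^2/n) <= |E T| <= q, two triangle inequalities reduce the theorem
    to |T - E T| = o(q) with high probability.

    The form <T - E T, x_1 ⊗ ... ⊗ x_r> is affine in every coordinate, so its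
    absolute value does not decrease when each coordinate is moved to one of
    its two neighbours in (1/s)Z; this leaves exp(O(n)) grid points. Let y(v)
    be the largest |x_j(v)| and Y(e) the product of y over the edge e. Edges
    with Y(e) < c q / n (light) are controlled by Bernstein's inequality and
    a union bound over the grid.

    For the heavy edges of the hypergraph, either Y(e) <= y(v)^2 for all v in e
    or Y(e) <= prod_(u in e - v) y(u)^2 for some v in e. The sum of Y over edges
    of the second kind is at most the largest codegree of an (r-1)-set times
    exp(sum y^2), and that codegree is O(1) + q n^(-1/4). For the first kind,
    the layer cake formula gives O(1) as soon as, for every integer vector m
    with sum m^2 = O(n), the number of hyperedges with
    prod_(v in e) m(v) >= c p n^(r-1) is O(|supp m|). This holds because there
    are at most |supp m|^r, and also at most O(1 / (p^2 n^(r-2))), candidate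
    edges, so on average at most O(|supp m| n^(-1/(2r))) of them are present,
    which survives a union bound over all m. *)

(** * Independent edges: product formula, Markov's inequality, exponential moments *)

Lemma expR_le1DxX2 (R : realType) (u : R) :
  u <= 2^-1 -> expR u <= 1 + u + 2 * u ^+ 2.
Proof.
move=> u2; have := expR_ge1Dx (- u); rewrite expRN => eu.
have u1 : 0 < 1 - u by lra.
have : expR u <= (1 - u)^-1 by rewrite -[expR u]invrK lef_pV2 // posrE ?invr_gt0 ?expR_gt0.
move=> /le_trans; apply; rewrite -div1r ler_pdivrMr //.
have : 0 <= u ^+ 2 * (1 - 2 * u) by rewrite mulr_ge0 ?sqr_ge0 //; lra.
by rewrite !expr2; lra.
Qed.

Section ErdosRenyi.
Variables (R : realType) (r n : nat) (p : R).
Hypothesis p01 : 0 <= p <= 1.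
Local Notation E := (hyperedges r n).

(** This is independence of the edges: expanding the product of sums gives one term for each set of
    edges. *)
Lemma ER_expect_prod (a b : {set 'I_n} -> R) :
  ER_expect r p (fun H => \prod_(e in E) (if e \in H then a e else b e)) =
  \prod_(e in E) (p * a e + (1 - p) * b e).
Proof.
(* Off [E], the values 0 for [F] and 1 for [G] kill every term of the expansion that is indexed by a
   set not contained in [E]. *)
pose F e := if e \in E then p * a e else 0.
pose G e := if e \in E then (1 - p) * b e else 1.
rewrite [RHS]big_mkcond /=.
rewrite [RHS](eq_bigr (fun e => F e + G e)); last first.
  by move=> e _; rewrite /F /G; case: ifP; rewrite ?add0r.
rewrite bigA_distr [RHS](bigID (mem (hypergraphs r n)))/=.
rewrite [X in _ = _ + X]big1 ?addr0 /ER_expect.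
  apply: eq_bigr => H; rewrite powersetE => /fintype.subsetP HE.
  rewrite /ER_weight -big_split /= big_mkcond; apply: eq_bigr => e _.
  rewrite /F /G; case: (boolP (e \in E)) => eE; first by case: ifP.
  by case: ifP => // /HE; rewrite (negPf eE).
move=> H; rewrite powersetE => /subsetPn[e eH eE].
by rewrite (bigD1 e) //= eH /F (negPf eE) mul0r.
Qed.

Lemma ER_weight_ge0 (H : {set {set 'I_n}}) : 0 <= ER_weight r p H.
Proof.
case/andP: p01 => p0 p1.
by apply: prodr_ge0 => e _; case: ifP => // _; rewrite subr_ge0.
Qed.

Lemma eq_ER_expect (f g : {set {set 'I_n}} -> R) :
  (forall H, H \in hypergraphs r n -> f H = g H) ->
  ER_expect r p f = ER_expect r p g.
Proof. by move=> fg; apply: eq_bigr => H HE; rewrite fg. Qed.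

Lemma ER_expect1 : ER_expect r p (fun _ : {set {set 'I_n}} => 1) = 1 :> R.
Proof.
transitivity (ER_expect r p (fun H : {set {set 'I_n}} =>
    \prod_(e in E) (if e \in H then 1 else 1) : R)).
  by apply: eq_ER_expect => H _; rewrite big1 // => e _; case: ifP.
rewrite (ER_expect_prod (fun=> 1) (fun=> 1)) big1 // => e _.
by rewrite !mulr1 addrC subrK.
Qed.

Lemma ER_expectD (f g : {set {set 'I_n}} -> R) :
  ER_expect r p (fun H => f H + g H) = ER_expect r p f + ER_expect r p g.
Proof. by rewrite -big_split; apply: eq_bigr => H _; rewrite mulrDr. Qed.

Lemma ER_expectZ c (f : {set {set 'I_n}} -> R) :
  ER_expect r p (fun H => f H * c) = ER_expect r p f * c.
Proof. by rewrite /ER_expect mulr_suml; apply: eq_bigr => H _; rewrite mulrA. Qed.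

Lemma ER_expect_sum (I : finType) (P : pred I) (f : I -> {set {set 'I_n}} -> R) :
  ER_expect r p (fun H => \sum_(i | P i) f i H) =
  \sum_(i | P i) ER_expect r p (f i).
Proof.
rewrite exchange_big /=; apply: eq_bigr => H _.
by rewrite mulr_sumr.
Qed.

Lemma ER_prob_le1 (A : pred (tensor R r n)) : ER_prob p A <= 1.
Proof.
rewrite -ER_expect1 /ER_prob /ER_expect big_mkcondr /=.
apply: ler_sum => H _; rewrite mulr1; case: ifP => // _.
exact: ER_weight_ge0.
Qed.

(** Markov's inequality, since [F >= 1] outside [A]. Each bad event below is encoded by a
    nonnegative statistic that is at least 1 on it, so a union of bad events becomes a sum of
    statistics. *)
Lemma ER_markov (A : pred (tensor R r n)) (F : {set {set 'I_n}} -> R) :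
  (forall H, H \in hypergraphs r n -> 0 <= F H) ->
  (forall H, H \in hypergraphs r n -> F H < 1 -> A (adj_tensor R r H)) ->
  1 - ER_expect r p F <= ER_prob p A.
Proof.
move=> F0 FA; rewrite -ER_expect1 lerBlDl /ER_prob big_mkcondr /=.
rewrite -big_split /=; apply: ler_sum => H HE; rewrite mulr1.
have w0 := ER_weight_ge0 H.
case: ifP => [_|AH]; first by rewrite lerDr mulr_ge0 ?F0.
rewrite addr0 ler_peMr //; case: (lerP 1 (F H)) => // /(FA _ HE).
by rewrite AH.
Qed.

(** By independence each edge satisfying [P] contributes a factor
    [p * z + (1 - p) <= expR (p * z)]. *)
Lemma ER_expect_count (z : R) (P : pred {set 'I_n}) : 1 <= z ->
  ER_expect r p (fun H => z ^+ #|[set e in H | P e]%SET|) <=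
  expR (p * z * #|[set e in E | P e]%SET|%:R).
Proof.
move=> z1; case/andP: p01 => p0 p1.
rewrite (@eq_ER_expect _ (fun H => \prod_(e in E)
   (if e \in H then (if P e then z else 1) else 1))); last first.
  move=> H; rewrite powersetE => /fintype.subsetP HE.
  rewrite -prodr_const big_mkcond [RHS]big_mkcond; apply: eq_bigr => e _.
  rewrite inE; case: (boolP (e \in H)) => [/HE ->|_] //=.
  by case: ifP.
rewrite ER_expect_prod -sum1_card natr_sum mulr_sumr.
rewrite expR_sum big_mkcond [leRHS]big_mkcond /=.
apply: ler_prod => e _.
have -> : (e \in [set e in E | P e]%SET) = (e \in E) && P e by rewrite finset.in_set.
case: (e \in E) => //=; last by rewrite ler01 lexx.
case: ifP => Pe; rewrite !mulr1; last by rewrite addrC subrK ler01 lexx.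
apply/andP; split; first by rewrite addr_ge0 ?mulr_ge0 ?subr_ge0 // (le_trans _ z1).
apply: le_trans (expR_ge1Dx _).
by rewrite addrC lerD2r lerBlDr lerDl.
Qed.

(** Bernstein's moment bound. The factor of an edge is [expR (- p * g e) * (1 + p * (expR (g e) -
    1))]; after the quadratic bound on [expR (g e)] the linear terms cancel. *)
Lemma ER_expect_expR (g : {set 'I_n} -> R) :
  (forall e, e \in E -> g e <= 2^-1) ->
  ER_expect r p (fun H => expR (\sum_(e in E) ((e \in H)%:R - p) * g e)) <=
  expR (2 * p * \sum_(e in E) g e ^+ 2).
Proof.
move=> g12; case/andP: p01 => p0 p1.
rewrite (@eq_ER_expect _ (fun H => \prod_(e in E)
   (if e \in H then expR ((1 - p) * g e) else expR (- p * g e)))); last first.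
  move=> H _; rewrite expR_sum; apply: eq_bigr => e _.
  by case: ifP => _; rewrite ?sub0r.
rewrite ER_expect_prod mulr_sumr expR_sum; apply: ler_prod => e eE.
apply/andP; split; first by rewrite addr_ge0 ?mulr_ge0 ?subr_ge0 ?expR_ge0.
rewrite mulrBl mul1r mulNr expRD mulrA -mulrDl expRN ler_pdivrMr ?expR_gt0 //.
rewrite -expRD; apply: le_trans (expR_ge1Dx _).
have := ler_wpM2l p0 (expR_le1DxX2 (g12 e eE)); lra.
Qed.

End ErdosRenyi.

(** * Basic bounds for the injective norm *)

Section InjectiveNorm.
Variables (R : realType) (r n : nat).
Implicit Types (A B : tensor R r n) (x : 'I_r -> 'rV[R]_n).

Lemma l2norm1_sum (v : 'rV[R]_n) :
  l2norm v = 1 -> \sum_(k < n) v ord0 k ^+ 2 = 1.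
Proof.
move=> v1; rewrite -[RHS](expr1n _ 2) -v1 sqr_sqrtr //.
by apply: sumr_ge0 => k _; rewrite sqr_ge0.
Qed.

Lemma l2norm1_coord (v : 'rV[R]_n) k : l2norm v = 1 -> `|v ord0 k| <= 1.
Proof.
move=> /l2norm1_sum v1; rewrite -(@expr_le1 _ 2) // -normrX ger0_norm ?sqr_ge0 //.
rewrite -v1 (bigD1 k) //= lerDl.
by apply: sumr_ge0 => i _; rewrite sqr_ge0.
Qed.

Lemma sum_tuple_prod (f : 'I_r -> 'I_n -> R) :
  \sum_(i : r.-tuple 'I_n) \prod_(j < r) f j (tnth i j) =
  \prod_(j < r) \sum_(k < n) f j k.
Proof.
rewrite bigA_distr_bigA /= (reindex (@tuple_of_finfun 'I_n r)) /=; last first.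
  by exists (@finfun_of_tuple 'I_n r) => i _;
    rewrite (tuple_of_finfunK, finfun_of_tupleK).
by apply: eq_bigr => f' _; apply: eq_bigr => j _; rewrite tnth_mktuple.
Qed.

Lemma inj_norm_ge A x : (forall j, l2norm (x j) = 1) ->
  `|tensor_inner A (rank_one x)| <= inj_norm A.
Proof.
move=> x1; apply: ub_le_sup; last by exists x.
exists (\sum_i `|A i|) => _ [u [u1 ->]].
apply: (le_trans (ler_norm_sum _ _ _)); apply: ler_sum => i _.
rewrite normrM ler_piMr // ffunE normr_prod.
by apply: prodr_ile1 => j _; rewrite normr_ge0 l2norm1_coord.
Qed.

Lemma l2norm_const : (0 < n)%N ->
  l2norm (const_mx (Num.sqrt n%:R)^-1 : 'rV[R]_n) = 1.
Proof.
move=> n0; rewrite /l2norm; under eq_bigr do rewrite mxE.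
rewrite sumr_const card_ord exprVn sqr_sqrtr // -[X in Num.sqrt X]mulr_natl.
by rewrite mulfV ?sqrtr1 // pnatr_eq0 -lt0n.
Qed.

Lemma inj_norm_le A b : (0 < n)%N ->
  (forall x, (forall j, l2norm (x j) = 1) ->
    `|tensor_inner A (rank_one x)| <= b) ->
  inj_norm A <= b.
Proof.
move=> n0 Ab; apply: ge_sup => [|_ [x [x1 ->]]]; last exact: Ab.
pose x0 (j : 'I_r) := const_mx (Num.sqrt n%:R)^-1 : 'rV[R]_n.
exists `|tensor_inner A (rank_one x0)|; exists x0; split=> // j.
exact: l2norm_const.
Qed.

Lemma tensor_innerB A B (X : tensor R r n) :
  tensor_inner (A - B) X = tensor_inner A X - tensor_inner B X.
Proof.
rewrite /tensor_inner -sumrB; apply: eq_bigr => i _.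
by rewrite !ffunE mulrBl.
Qed.

Lemma inj_norm_leB A B : (0 < n)%N ->
  inj_norm A <= inj_norm (A - B) + inj_norm B.
Proof.
move=> n0; apply: inj_norm_le => // x x1.
have -> : tensor_inner A (rank_one x) =
  tensor_inner (A - B) (rank_one x) + tensor_inner B (rank_one x).
  by rewrite tensor_innerB subrK.
apply: (le_trans (ler_normD _ _)).
by apply: lerD; apply: inj_norm_ge.
Qed.

Lemma inj_norm_leBr A B : (0 < n)%N ->
  inj_norm B <= inj_norm A + inj_norm (A - B).
Proof.
move=> n0; apply: inj_norm_le => // x x1.
have -> : tensor_inner B (rank_one x) =
  tensor_inner A (rank_one x) - tensor_inner (A - B) (rank_one x).
  by rewrite tensor_innerB; lra.
apply: (le_trans (ler_normB _ _)).
by apply: lerD; apply: inj_norm_ge.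
Qed.

End InjectiveNorm.

(** * Rounding multi-affine functions to a grid *)

Section Rounding.
Variable (R : realType).

(** The absolute value of an affine function is convex, so on an interval it is largest at an
    endpoint. *)
Lemma affine_norm_le (a b u v t : R) : u <= t <= v ->
  `|a + b * t| <= `|a + b * u| \/ `|a + b * t| <= `|a + b * v|.
Proof.
move=> /andP[ut tv].
case: (lerP 0 (a + b * t)) => s.
  case: (lerP 0 b) => b0; [right|left].
    have h : b * t <= b * v by rewrite ler_wpM2l.
    by rewrite !ger0_norm //; lra.
  have h : b * t <= b * u by rewrite ler_wnM2l // ltW.
  by rewrite !ger0_norm //; lra.
case: (lerP 0 b) => b0; [left|right].
  have h : b * u <= b * t by rewrite ler_wpM2l.
  by rewrite !ltr0_norm //; lra.
have h : b * v <= b * t by rewrite ler_wnM2l // ltW.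
by rewrite !ltr0_norm //; lra.
Qed.

Lemma grid_neighbours (s t : R) : 0 < s -> exists u v : bool * nat,
  [/\ (-1) ^+ u.1 * u.2%:R / s <= t <= (-1) ^+ v.1 * v.2%:R / s,
      u.2%:R <= `|t| * s + 1 & v.2%:R <= `|t| * s + 1].
Proof.
(* The neighbours of [t] have its sign and magnitudes [l / s] and [l.+1 / s]. Only the one farther
   from 0 can exceed [|t|], and by at most [1 / s]. *)
move=> s0; pose l := Num.trunc (`|t| * s).
have /andP[l1 l2] : l%:R <= `|t| * s < l.+1%:R.
  by apply: truncn_itv; rewrite mulr_ge0 // ltW.
have h1 : l%:R / s <= `|t| by rewrite ler_pdivrMr.
have h2 : `|t| <= l.+1%:R / s by rewrite ler_pdivlMr // ltW.
have h3 : l%:R <= `|t| * s + 1 by rewrite (le_trans l1) // lerDl.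
have h4 : l.+1%:R <= `|t| * s + 1 by rewrite -natr1 lerD2r.
case: (lerP 0 t) => t0.
  exists (false, l), (false, l.+1); split=> //=.
  by rewrite !expr0 !mul1r; move: h1 h2; rewrite ger0_norm // => -> ->.
exists (true, l.+1), (true, l); split=> //=.
rewrite !expr1 !mulN1r !mulNr; move: h1 h2; rewrite ltr0_norm //.
by move=> h1 h2; apply/andP; split; lra.
Qed.

(** The coordinates are rounded one after the other, each to the neighbour that does not decrease
    the absolute value while the others stay fixed. *)
Lemma round_multiaffine (I : finType) (F : (I -> R) -> R) (s : R) (u : I -> R) :
  0 < s ->
  (forall w c, exists a b, forall t,
     F (fun d => if d == c then t else w d) = a + b * t) ->
  (forall w w', w =1 w' -> F w = F w') ->
  exists K : I -> bool * nat, (forall c, (K c).2%:R <= `|u c| * s + 1) /\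
    `|F u| <= `|F (fun c => (-1) ^+ (K c).1 * (K c).2%:R / s)|.
Proof.
move=> s0 aff ext; pose g (k : bool * nat) : R := (-1) ^+ k.1 * k.2%:R / s.
have step (l : seq I) : uniq l -> exists K : I -> bool * nat,
    (forall c, c \in l -> (K c).2%:R <= `|u c| * s + 1) /\
    `|F u| <= `|F (fun c => if c \in l then g (K c) else u c)|.
  elim: l => [_|c l IH /= /andP[cl ul]]; first by exists (fun=> (false, 0%N)).
  have [K [K1 K2]] := IH ul.
  set w := (fun d => if d \in l then g (K d) else u d) in K2.
  have [a [b ab]] := aff w c.
  have Fw : F w = a + b * u c.
    rewrite -ab; apply: ext => d; case: eqP => // ->.
    by rewrite /w (negPf cl).
  have [k1 [k2 [k12 k1u k2u]]] := grid_neighbours (u c) s0.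
  have fin (k : bool * nat) : k.2%:R <= `|u c| * s + 1 ->
      `|a + b * u c| <= `|a + b * g k| ->
      exists K : I -> bool * nat,
      (forall d, d \in c :: l -> (K d).2%:R <= `|u d| * s + 1) /\
      `|F u| <= `|F (fun d => if d \in c :: l then g (K d) else u d)|.
    move=> ku kk; exists (fun d => if d == c then k else K d); split.
      by move=> d; rewrite inE; case: eqP => [->//|_ /=]; apply: K1.
    apply: (le_trans K2); rewrite Fw (le_trans kk) // -ab.
    rewrite le_eqVlt; apply/orP; left; apply/eqP; congr (`| _ |).
    by apply: ext => d; rewrite inE /w; case: eqP.
  by case: (affine_norm_le a b k12); apply: fin.
have [K [K1 K2]] := step _ (enum_uniq I).
exists K; split=> [c|]; first by apply: K1; rewrite mem_enum.
apply: (le_trans K2); rewrite le_eqVlt; apply/orP; left; apply/eqP.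
by congr (`| _ |); apply: ext => c; rewrite mem_enum.
Qed.

(** A multi-index meets the coordinate [(j0, k0)] in its factor [j0] or not at all, so the degree in
    that coordinate is at most one. *)
Lemma tensor_inner_affine r n (A : tensor R r n) (w : 'I_r * 'I_n -> R) c :
  exists a b, forall t, tensor_inner A (rank_one (fun j => \row_k
     (if (j, k) == c then t else w (j, k)))) = a + b * t.
Proof.
case: c => j0 k0.
pose P (i : r.-tuple 'I_n) := A i * \prod_(j < r | j != j0) w (j, tnth i j).
exists (\sum_(i | tnth i j0 != k0) P i * w (j0, tnth i j0)).
exists (\sum_(i | tnth i j0 == k0) P i) => t.
rewrite /tensor_inner (bigID (fun i : r.-tuple 'I_n => tnth i j0 == k0)) /= addrC.
have E i t' : \prod_(j < r | j != j0) (\row_k (if (j, k) == (j0, k0) then t'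
    else w (j, k))) ord0 (tnth i j) = \prod_(j < r | j != j0) w (j, tnth i j).
  by apply: eq_bigr => j jj0; rewrite mxE xpair_eqE (negPf jj0).
congr (_ + _); rewrite ?mulr_suml; apply: eq_bigr => i ik;
  rewrite ffunE (bigD1 j0) //= mxE xpair_eqE eqxx ?ik ?(negPf ik) /= E /P;
  by rewrite mulrCA mulrC.
Qed.

Lemma tensor_inner_round r n (A : tensor R r n) (x : 'I_r -> 'rV[R]_n) (s : R) :
  0 < s -> exists K : 'I_r * 'I_n -> bool * nat,
  (forall j k, (K (j, k)).2%:R <= `|x j ord0 k| * s + 1) /\
  `|tensor_inner A (rank_one x)| <= `|tensor_inner A (rank_one (fun j =>
     \row_k ((-1) ^+ (K (j, k)).1 * (K (j, k)).2%:R / s)))|.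
Proof.
move=> s0.
pose F (w : 'I_r * 'I_n -> R) :=
  tensor_inner A (rank_one (fun j => \row_k w (j, k))).
have ext w w' : w =1 w' -> F w = F w'.
  move=> ww'; apply: eq_bigr => i _; rewrite !ffunE; congr (_ * _).
  by apply: eq_bigr => j _; rewrite !mxE ww'.
have [K [K1 K2]] := @round_multiaffine _ F s (fun c => x c.1 ord0 c.2) s0
  (tensor_inner_affine A) ext.
exists K; split=> [j k|]; first exact: (K1 (j, k)).
apply: le_trans K2; rewrite le_eqVlt; apply/orP; left; apply/eqP.
congr (`| _ |); apply: eq_bigr => i _; rewrite !ffunE; congr (_ * _).
by apply: eq_bigr => j _; rewrite !mxE.
Qed.

End Rounding.

(** * Edge weights: second moment, reduction to sums over edges, splitting *)

Section EdgeWeights.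
Variables (R : realType) (r n : nat).
Local Notation E := (hyperedges r n).
Implicit Types (x : 'I_r -> 'rV[R]_n) (y : 'I_n -> R) (e : {set 'I_n}).

(** The sum over all vertex sets factors as the product of [1 + y v ^+ 2] over the vertices. *)
Lemma sum_sqr_prod_le y (P : pred {set 'I_n}) :
  \sum_(e | P e) (\prod_(v in e) y v) ^+ 2 <= expR (\sum_v y v ^+ 2).
Proof.
apply: (@le_trans _ _ (\sum_(e : {set 'I_n}) (\prod_(v in e) y v) ^+ 2)).
  rewrite [leRHS](bigID P) /= lerDl.
  by apply: sumr_ge0 => e _; rewrite sqr_ge0.
rewrite expR_sum.
apply: (@le_trans _ _ (\prod_(v < n) (y v ^+ 2 + 1))); last first.
  apply: ler_prod => v _; rewrite addr_ge0 ?sqr_ge0 //=.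
  by rewrite addrC expR_ge1Dx.
rewrite bigA_distr le_eqVlt; apply/orP; left; apply/eqP/eq_bigr => e _.
by rewrite -prodrXl big_mkcond.
Qed.

(** The coefficient of the edge [e] in the multilinear form: all orderings of [e] share one tensor
    entry. *)
Definition edge_coef x e : R :=
  \sum_(i : r.-tuple 'I_n | [set k in i]%SET == e)
    \prod_(j < r) x j ord0 (tnth i j).

Lemma edge_tuple_uniq (i : r.-tuple 'I_n) : [set k in i]%SET \in E -> uniq i.
Proof.
rewrite finset.in_set cardsE => /eqP ci.
by apply/card_uniqP; rewrite ci size_tuple.
Qed.

Lemma edge_coef_le x y e : e \in E ->
  (forall j v, `|x j ord0 v| <= y v) ->
  `|edge_coef x e| <= (r`!)%:R * \prod_(v in e) y v.
Proof.
move=> eE xy; have y0 v j : 0 <= y v := le_trans (normr_ge0 _) (xy j v).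
apply: (le_trans (ler_norm_sum _ _ _)).
apply: (@le_trans _ _ (\sum_(i : r.-tuple 'I_n | [set k in i]%SET == e)
   \prod_(v in e) y v)).
  apply: ler_sum => i /eqP ie; rewrite normr_prod.
  apply: (@le_trans _ _ (\prod_(j < r) y (tnth i j))).
    by apply: ler_prod => j _; rewrite normr_ge0 xy.
  rewrite -(big_tuple _ _ i xpredT y) big_uniq; last first.
    by apply: edge_tuple_uniq; rewrite ie.
  by rewrite -ie; under [leRHS]eq_bigl do rewrite finset.in_set.
(* For [r = 0] no index [j] provides [0 <= y], but then [e] is empty and the product is 1. *)
have P0 : 0 <= \prod_(v in e) y v.
  case: r x xy y0 eE => [|r'] x xy y0 eE; last first.
    by apply: prodr_ge0 => v _; apply: y0 ord0.
  rewrite big1 // => v; move: eE; rewrite finset.in_set cards_eq0 => /eqP ->.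
  by rewrite finset.in_set0.
rewrite sumr_const -[leLHS]mulr_natl ler_wpM2r // ler_nat.
have /eqP ce : #|e| == r by move: eE; rewrite finset.in_set.
rewrite -ffactnn -[X in (_ <= X ^_ _)%N]ce -card_uniq_tuples -cardsE.
apply/subset_leq_card/fintype.subsetP => i; rewrite !finset.in_set => ii.
have ie : [set k in i]%SET = e by apply/eqP.
apply/andP; split; last by apply: edge_tuple_uniq; rewrite ie.
apply/allP => k ki; suff : k \in e by [].
by rewrite -ie finset.in_set.
Qed.

Lemma mean_tensorE (p : R) (i : r.-tuple 'I_n) :
  mean_tensor r n p i = if [set k in i]%SET \in E then p else 0.
Proof.
rewrite ffunE; case: ifPn => iE; last first.
  rewrite /ER_expect big1 // => H; rewrite powersetE => /fintype.subsetP HE.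
  by rewrite ffunE; case: (boolP (_ \in H)) => [/HE|_]; rewrite ?(negPf iE) // mulr0.
set e0 := [set k in i]%SET in iE *.
(* With [b] zero only at [e0], the indicator of [e0 \in H] becomes a product over all edges, to
   which [ER_expect_prod] applies. *)
pose b (e : {set 'I_n}) : R := (e != e0)%:R.
rewrite (@eq_ER_expect _ _ _ _ _ (fun H => \prod_(e in E)
   (if e \in H then 1 else b e))).
  rewrite (@ER_expect_prod R r n p (fun=> 1) b) (bigD1 e0) //= /b eqxx mulr0 addr0 mulr1.
  rewrite big1 ?mulr1 // => e /andP[_ ->]; by rewrite !mulr1 addrC subrK.
move=> H _; rewrite ffunE -/e0 (bigD1 e0) //=.
rewrite [X in _ * X]big1 ?mulr1; first by rewrite /b eqxx; case: ifP.
by move=> e /andP[_ ee]; rewrite /b ee; case: ifP.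
Qed.

(** Multi-indices are grouped by their underlying set; if this is not an [r]-set, both tensors
    vanish there. *)
Lemma centered_inner (p : R) x H : H \in hypergraphs r n ->
  tensor_inner (adj_tensor R r H - mean_tensor r n p) (rank_one x) =
  \sum_(e in E) ((e \in H)%:R - p) * edge_coef x e.
Proof.
rewrite powersetE => /fintype.subsetP HE.
rewrite /tensor_inner.
rewrite (partition_big (fun i : r.-tuple 'I_n => [set k in i]%SET) xpredT) //=.
rewrite [RHS]big_mkcond; apply: eq_bigr => e _.
case: ifPn => eE; rewrite ?mulr_sumr.
  apply: eq_bigr => i /eqP ie; rewrite !ffunE.
  have := mean_tensorE p i; rewrite ffunE => ->.
  by rewrite ie eE.
rewrite big1 // => i /eqP ie; rewrite !ffunE.
have := mean_tensorE p i; rewrite ffunE => ->.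
rewrite ie (negPf eE); case: (boolP (e \in H)) => [/HE|_].
  by rewrite (negPf eE).
by rewrite subrr mul0r.
Qed.

(** The discrete layer cake formula for squares, applied below with [l = m v]. *)
Lemma sum_odd_layers (l : nat) : (l <= n)%N ->
  (\sum_(t < n | t < l) t.*2.+1)%N = (l ^ 2)%N.
Proof.
move=> ln; rewrite -(big_ord_widen _ (fun t => t.*2.+1) ln).
elim: l {ln} => [|l IH]; first by rewrite big_ord0.
rewrite big_ord_recr /= IH -addnn; ring.
Qed.

(* Either all [y v ^ 2] in the edge dominate its weight, which is then handled
   by the layers [t < m v], or the weight is at most the square of the product
   over the edge minus one vertex, which is handled by the codegrees. *)
Lemma edge_weight_split (m : 'I_n -> nat) (s : R) e :
  0 < s -> s ^+ 2 = n%:R -> (forall v, m v <= n)%N -> e \in E -> (0 < r)%N ->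
  \prod_(v in e) ((m v)%:R / s) <=
  (\sum_(t < n) t.*2.+1%:R * (e \subset [set v | (t < m v)%N]%SET)%:R) / n%:R +
  \sum_(f : {set 'I_n} | (#|f| == r.-1) && (f \subset e))
    (\prod_(v in f) ((m v)%:R / s)) ^+ 2.
Proof.
move=> s0 s2 mn eE r0; set Y := \prod_(v in e) _.
have y0 v : 0 <= (m v)%:R / s by rewrite divr_ge0 // ltW.
have S1 : 0 <= (\sum_(t < n) t.*2.+1%:R *
    (e \subset [set v | (t < m v)%N]%SET)%:R) / n%:R :> R.
  by rewrite divr_ge0 // sumr_ge0 // => t _; rewrite mulr_ge0.
have S2 : 0 <= \sum_(f : {set 'I_n} | (#|f| == r.-1) && (f \subset e))
    (\prod_(v in f) ((m v)%:R / s)) ^+ 2.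
  by rewrite sumr_ge0 // => f _; rewrite sqr_ge0.
have ce : #|e| = r by move: eE; rewrite finset.in_set => /eqP.
case: (boolP [forall v in e, Y <= ((m v)%:R / s) ^+ 2]).
  move=> /forall_inP YA.
  have /card_gt0P[v0 v0e] : (0 < #|e|)%N by rewrite ce.
  case: (arg_minnP m v0e) => v ve vmin.
  apply: (le_trans (YA _ ve)); rewrite -[leLHS]addr0 lerD //.
  rewrite expr_div_n s2 ler_wpM2r ?invr_ge0 //.
  rewrite -natrX -(sum_odd_layers (mn v)) natr_sum big_mkcond /=.
  apply: ler_sum => t _; case: ifP => tv; last by rewrite mulr_ge0.
  have -> : e \subset [set v | (t < m v)%N]%SET.
    apply/fintype.subsetP => u ue; rewrite finset.in_set.
    exact: leq_trans tv (vmin _ ue).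
  by rewrite mulr1.
rewrite negb_forall_in => /exists_inP[v ve]; rewrite -ltNge => vY.
rewrite -[leLHS]add0r lerD //.
rewrite (bigD1 (e :\ v)%SET) /=; last first.
  by rewrite subD1set andbT -ce (cardsD1 v e) ve.
have YE : Y = (m v)%:R / s * \prod_(u in (e :\ v)%SET) ((m u)%:R / s).
  rewrite /Y (bigD1 v) //=; congr (_ * _); apply: eq_bigl => u.
  by rewrite finset.in_setD1 andbC.
set Q := \prod_(u in _) _ in YE *.
rewrite -[leLHS]addr0 lerD //; last first.
  by rewrite sumr_ge0 // => f _; rewrite sqr_ge0.
have Q0 : 0 <= Q by apply: prodr_ge0.
(* Here [Y = a * Q] exceeds [a ^+ 2], which forces [a <= Q] and hence [Y <= Q ^+ 2]. *)
move: vY; rewrite YE !expr2; set a := (_ / s) => aQ.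
have a0 : 0 <= a by apply: y0.
rewrite ler_wpM2r // leNgt; apply/negP => Qa.
by move: aQ; rewrite ltNge ler_wpM2l // ltW.
Qed.

End EdgeWeights.

(** * Heavy edges: weighted sums and deterministic counts *)

Section HeavyEdges.
Variables (R : realType) (r n : nat) (s : R).
Hypotheses (s_gt0 : 0 < s) (s2 : s ^+ 2 = n%:R) (r_gt0 : (0 < r)%N).
Local Notation E := (hyperedges r n).
Implicit Types (m : {ffun 'I_n -> 'I_n.+1}) (e f : {set 'I_n}).

Definition msupp m := [set v | m v != 0 :> nat]%SET.
Definition mass m := (\sum_v m v ^ 2)%N.
(** With [y = m / s], an edge of weight at least [tau] is one that is heavy for
    [theta = tau * s ^+ r]. *)
Definition heavy (theta : R) m e := theta <= \prod_(v in e) (m v)%:R.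

Lemma mass_sum_sqr m (k : nat) : (0 < n)%N -> (mass m <= k * n)%N ->
  \sum_v ((m v)%:R / s) ^+ 2 <= k%:R.
Proof.
move=> n0 mk; under eq_bigr do rewrite expr_div_n s2 -natrX.
rewrite -mulr_suml -natr_sum ler_pdivrMr ?ltr0n // -natrM ler_nat.
exact: mk.
Qed.

(** Let [mt] be [m] cut to zero off the level set [t < m v]. A heavy edge inside the level set is
    heavy for [mt], whose support is the level set, so the count hypothesis bounds each layer;
    summing level-set sizes with weights [t.*2.+1] restores the mass. *)
Lemma sum_layers_le m (theta b : R) H : 0 < theta -> H \in hypergraphs r n ->
  0 <= b ->
  (forall m', (mass m' <= mass m)%N ->
    #|[set e in H | heavy theta m' e]%SET|%:R <= b * #|msupp m'|%:R) ->
  \sum_(e in H | heavy theta m e) \sum_(t < n) t.*2.+1%:R *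
    (e \subset [set v | (t < m v)%N]%SET)%:R <= b * (mass m)%:R.
Proof.
move=> th0 HE b0 good; rewrite exchange_big /=.
apply: (@le_trans _ _ (\sum_(t < n) t.*2.+1%:R *
    (b * #|[set v | (t < m v)%N]%SET|%:R))).
  apply: ler_sum => t _; rewrite -mulr_sumr ler_wpM2l //.
  pose mt : {ffun 'I_n -> 'I_n.+1} := [ffun v => if (t < m v)%N then m v else ord0].
  have mtm : (mass mt <= mass m)%N.
    by apply: leq_sum => v _; rewrite ffunE; case: ifP => // _; rewrite exp0n.
  have smt : msupp mt = [set v | (t < m v)%N]%SET.
    apply/setP => v; rewrite !finset.in_set ffunE; case: ifP => // tv.
    by rewrite -lt0n (leq_trans _ tv).
  rewrite -smt; apply: le_trans (good _ mtm).
  rewrite -natr_sum ler_nat -sum1_card big_mkcond [leqRHS]big_mkcond /=.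
  apply: leq_sum => e _; rewrite finset.in_set.
  case: (boolP (e \in H)) => //= eH; case: (boolP (heavy _ m e)) => //= he.
  case: (boolP (e \subset _)) => //= /fintype.subsetP sub.
  suff -> : heavy theta mt e by [].
  rewrite /heavy (eq_bigr (fun v => (m v)%:R)) // => v /sub.
  by rewrite smt finset.in_set ffunE => ->.
under eq_bigr do rewrite mulrCA.
rewrite -mulr_sumr ler_wpM2l // /mass.
rewrite natr_sum.
rewrite [leLHS](eq_bigr (fun t : 'I_n => \sum_v
    if (t < m v)%N then t.*2.+1%:R else 0)); last first.
  move=> t _; rewrite -sum1_card natr_sum mulr_sumr big_mkcond /=.
  by apply: eq_bigr => v _; rewrite finset.in_set mulr1.
rewrite exchange_big /=; apply: ler_sum => v _.
have mn : (m v <= n)%N by rewrite -ltnS.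
rewrite -(sum_odd_layers mn) natr_sum.
by rewrite -big_mkcond.
Qed.

(** After exchanging the sums, each [f] is counted once per hyperedge containing it. *)
Lemma sum_codegree_le m (d : R) (H : {set {set 'I_n}}) : 0 <= d ->
  (forall f, #|f| = r.-1 -> #|[set e in H | f \subset e]%SET|%:R <= d) ->
  \sum_(e in H) \sum_(f : {set 'I_n} | (#|f| == r.-1) && (f \subset e))
    (\prod_(v in f) ((m v)%:R / s)) ^+ 2 <=
  d * expR (\sum_v ((m v)%:R / s) ^+ 2).
Proof.
move=> d0 good.
rewrite (exchange_big_dep (fun f : {set 'I_n} => #|f| == r.-1)) /=; last first.
  by move=> e f _ /andP[].
apply: (@le_trans _ _ (d * \sum_(f : {set 'I_n} | #|f| == r.-1)
    (\prod_(v in f) ((m v)%:R / s)) ^+ 2)); last first.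
  by rewrite ler_wpM2l // sum_sqr_prod_le.
rewrite mulr_sumr; apply: ler_sum => f /eqP cf; rewrite cf eqxx /=.
rewrite sumr_const -[leLHS]mulr_natl ler_wpM2r ?sqr_ge0 //.
by apply: le_trans (good _ cf); rewrite -cardsE.
Qed.

Lemma heavy_sum_le m (theta b d : R) (k : nat) H :
  (0 < n)%N -> 0 < theta -> H \in hypergraphs r n -> 0 <= b -> 0 <= d ->
  (mass m <= k * n)%N ->
  (forall m', (mass m' <= mass m)%N ->
    #|[set e in H | heavy theta m' e]%SET|%:R <= b * #|msupp m'|%:R) ->
  (forall f, #|f| = r.-1 -> #|[set e in H | f \subset e]%SET|%:R <= d) ->
  \sum_(e in H | heavy theta m e) \prod_(v in e) ((m v)%:R / s) <=
  b * k%:R + d * expR k%:R.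
Proof.
move=> n0 th0 HE b0 d0 mk good1 good2.
have n0' : 0 < n%:R :> R by rewrite ltr0n.
have mn v : (m v <= n)%N by rewrite -ltnS.
have eE e : e \in H -> e \in E.
  by move: HE; rewrite powersetE => /fintype.subsetP; apply.
apply: (@le_trans _ _ (\sum_(e in H | heavy theta m e)
  ((\sum_(t < n) t.*2.+1%:R * (e \subset [set v | (t < m v)%N]%SET)%:R) / n%:R +
  \sum_(f : {set 'I_n} | (#|f| == r.-1) && (f \subset e))
    (\prod_(v in f) ((m v)%:R / s)) ^+ 2))).
  by apply: ler_sum => e /andP[eH _]; apply: edge_weight_split => //; apply: eE.
rewrite big_split /= lerD //.
  rewrite -mulr_suml ler_pdivrMr //.
  apply: (le_trans (sum_layers_le th0 HE b0 good1)).
  by rewrite -mulrA -natrM ler_wpM2l // ler_nat.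
apply: (@le_trans _ _ (d * expR (\sum_v ((m v)%:R / s) ^+ 2))).
  apply: le_trans (sum_codegree_le m d0 good2).
  rewrite [leRHS](bigID (heavy theta m)) /= lerDl.
  by apply: sumr_ge0 => e _; apply: sumr_ge0 => f _; rewrite sqr_ge0.
by rewrite ler_wpM2l // ler_expR mass_sum_sqr.
Qed.

Lemma card_draws_le (T : finType) (B : {set T}) k :
  (#|[set A : {set T} | A \subset B & #|A| == k]%SET| <= #|B| ^ k)%N.
Proof.
rewrite cards_draws; apply: (@leq_trans ('C(#|B|, k) * k`!)).
  by rewrite leq_pmulr // fact_gt0.
rewrite bin_ffact; elim: k => // k IH.
by rewrite ffactnSr expnSr leq_mul // leq_subr.
Qed.

(** Since [theta > 0], a heavy edge contains no zero of [m], so it is an [r]-subset of the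
    support. *)
Lemma card_heavy_le_supp m theta : 0 < theta ->
  (#|[set e in E | heavy theta m e]%SET| <= #|msupp m| ^ r)%N.
Proof.
move=> th0; apply: leq_trans (card_draws_le _ _).
apply/subset_leq_card/fintype.subsetP => e; rewrite !finset.in_set.
move=> /andP[-> he]; rewrite andbT; apply/fintype.subsetP => v ve.
rewrite finset.in_set; apply/negP => /eqP mv0.
move: he; rewrite /heavy (bigD1 v) //= mv0 mul0r.
by rewrite leNgt th0.
Qed.

(** Chebyshev's inequality: each heavy edge adds at least [theta ^+ 2 / n%:R ^+ r] to a sum of
    squared weights that is at most [expR k%:R]. *)
Lemma card_heavy_le_mass m theta (k : nat) : (0 < n)%N -> 0 < theta ->
  (mass m <= k * n)%N ->
  #|[set e in E | heavy theta m e]%SET|%:R * theta ^+ 2 <=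
  n%:R ^+ r * expR k%:R.
Proof.
move=> n0 th0 mk; have n0' : 0 < n%:R :> R by rewrite ltr0n.
apply: (@le_trans _ _ (n%:R ^+ r *
   \sum_(e in [set e in E | heavy theta m e]%SET)
     (\prod_(v in e) ((m v)%:R / s)) ^+ 2)); last first.
  rewrite ler_wpM2l ?exprn_ge0 //.
  apply: (le_trans (sum_sqr_prod_le (fun v => (m v)%:R / s)
    (fun e => e \in [set e in E | heavy theta m e]%SET))).
  by rewrite ler_expR mass_sum_sqr.
rewrite mulr_sumr mulr_natl -sumr_const; apply: ler_sum => e.
rewrite !finset.in_set => /andP[/eqP ce he].
rewrite big_split /= prodr_const ce exprMn mulrCA -exprM mulnC exprM exprVn s2.
rewrite exprVn mulfV ?mulr1 ?expf_neq0 ?gt_eqF //.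
by rewrite ler_pXn2r // nnegrE ?ltW // (lt_le_trans th0).
Qed.

Lemma card_codegree_le f : #|f| = r.-1 ->
  (#|[set e in E | f \subset e]%SET| <= n)%N.
Proof.
move=> cf; rewrite -[n in (_ <= n)%N]card_ord.
apply: leq_trans (leq_imset_card (fun v => v |: f)%SET _).
apply/subset_leq_card/fintype.subsetP => e; rewrite !finset.in_set.
move=> /andP[/eqP ce fe].
have /card_gt0P[v] : (0 < #|e :\: f|)%N.
  by rewrite cardsD (finset.setIidPr fe) ce cf subn_gt0 prednK.
rewrite finset.in_setD => /andP[vf ve].
apply/imsetP; exists v => //; apply/eqP; rewrite eq_sym eqEcard.
rewrite cardsU1 vf cf ce add1n prednK // leqnn andbT.
by rewrite finset.subUset finset.sub1set ve.
Qed.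

End HeavyEdges.

(** * Random counts of heavy edges and codegrees *)

Section SparseStatistics.
Variables (R : realType) (r n : nat) (p s : R).
Hypotheses (p01 : 0 <= p <= 1) (s_ge1 : 1 <= s) (s2 : s ^+ 2 = n%:R).
Hypotheses (r_ge3 : (3 <= r)%N) (q_ge1 : 1 <= p * s ^+ r).
Local Notation E := (hyperedges r n).
Implicit Types (m : {ffun 'I_n -> 'I_n.+1}) (e f : {set 'I_n}).

Let s_gt0 : 0 < s. Proof. exact: lt_le_trans s_ge1. Qed.
Let r_gt0 : (0 < r)%N. Proof. exact: ltn_trans r_ge3. Qed.
Let nR_gt0 : 0 < n%:R :> R. Proof. by rewrite -s2 exprn_gt0. Qed.
Let n_gt0 : (0 < n)%N. Proof. by move: nR_gt0; rewrite ltr0n. Qed.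
Let p_gt0 : 0 < p.
Proof.
case/andP: p01; rewrite le_eqVlt => /orP[/eqP p0|//].
by move: q_ge1; rewrite -p0 mul0r leNgt ltr01.
Qed.

(* The geometric mean of the two bounds on the number of heavy edges,
   with weights [1 / r] and [1 - 1 / r]. *)
Lemma heavy_mean_le m (c z C : R) (k : nat) : 0 < c -> 0 <= z -> z ^+ r = s ->
  1 <= C -> expR k%:R <= C * c ^+ 2 -> (mass m <= k * n)%N ->
  p * z * #|[set e in E | heavy (c * p * n%:R ^+ r.-1) m e]%SET|%:R <=
  C * #|msupp m|%:R.
Proof.
move=> c0 z0 zr C1 Cc mk; set th := c * p * _.
have rE : (r.-1 * 2 = r + r.-2)%N.
  by case: (r) r_ge3 => [//|[//|a]] _ /=; rewrite muln2 -addnn !addSn !addnS.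
have th0 : 0 < th by rewrite !mulr_gt0 // exprn_gt0.
have C0 : 0 < C by apply: lt_le_trans C1.
have := card_heavy_le_supp r m th0.
have := card_heavy_le_mass r s2 n_gt0 th0 mk.
set N := #|_|; set K := #|_| => h1 h2.
have h1' : N%:R * (p ^+ 2 * n%:R ^+ r.-2) <= C.
  move: h1; rewrite /th !exprMn -exprM rE exprD => h1.
  have X0 : 0 < c ^+ 2 * n%:R ^+ r by rewrite mulr_gt0 // exprn_gt0.
  rewrite -(ler_pM2r X0).
  have -> : N%:R * (p ^+ 2 * n%:R ^+ r.-2) * (c ^+ 2 * n%:R ^+ r) =
    N%:R * (c ^+ 2 * p ^+ 2 * (n%:R ^+ r * n%:R ^+ r.-2)) by ring.
  apply: (le_trans h1).
  have -> : C * (c ^+ 2 * n%:R ^+ r) = n%:R ^+ r * (C * c ^+ 2) by ring.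
  by rewrite ler_wpM2l ?exprn_ge0.
have a1 : (0 < r.-2)%N by case: (r) r_ge3 => [//|[//|[]]].
(* The right side is [p ^+ r * (p * n%:R ^+ r.-1) ^+ r.-2], and [p * n%:R ^+ r.-1 = (p * s ^+ r) * s
   ^+ r.-2 >= s]. Both [1 <= p * s ^+ r] and [3 <= r] enter here. *)
have key : s * p ^+ r <= (p ^+ 2 * n%:R ^+ r.-2) ^+ r.-1.
  have -> : (p ^+ 2 * n%:R ^+ r.-2) ^+ r.-1 = p ^+ r * (p * n%:R ^+ r.-1) ^+ r.-2.
    have e1 : (p ^+ 2) ^+ r.-1 = p ^+ r * p ^+ r.-2.
      by rewrite -exprM mulnC rE exprD.
    have e2 : (n%:R ^+ r.-2) ^+ r.-1 = (n%:R ^+ r.-1) ^+ r.-2 :> R.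
      by rewrite -!exprM mulnC.
    by rewrite [LHS]exprMn e1 e2 [in RHS]exprMn mulrA.
  rewrite mulrC ler_wpM2l ?exprn_ge0 ?(ltW p_gt0) //.
  have sp : s <= p * n%:R ^+ r.-1.
    rewrite -s2 -exprM [(2 * r.-1)%N]mulnC rE exprD mulrA -[leLHS]mul1r; apply: ler_pM => //; first exact: ltW.
    by rewrite -[leLHS]expr1 ler_weXn2l.
  apply: (le_trans sp); rewrite -[leLHS]expr1 ler_weXn2l //.
  exact: le_trans sp.
have N0 : 0 <= N%:R :> R by [].
rewrite -(@ler_pXn2r _ r) // ?nnegrE ?mulr_ge0 //; try exact: ltW.
have rr : r = r.-1.+1 by rewrite prednK.
(* In the [r]-th power of the claim, one factor [N] is bounded by [K ^ r] and the other [r.-1] by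
   [h1']; [key] absorbs [p ^+ r * z ^+ r = p ^+ r * s]. *)
apply: (@le_trans _ _ (K%:R ^+ r * (N%:R * (p ^+ 2 * n%:R ^+ r.-2)) ^+ r.-1)).
  move: key; set X := p ^+ 2 * _ => key.
  rewrite exprMn (exprMn _ p z) zr (exprMn _ N%:R X).
  apply: (@le_trans _ _ (N%:R ^+ r.-1 * (s * p ^+ r) * N%:R)).
    by rewrite {2}rr exprSr le_eqVlt; apply/orP; left; apply/eqP; ring.
  rewrite [leRHS]mulrC; apply: ler_pM => //.
  - by rewrite !mulr_ge0 ?exprn_ge0 ?(ltW p_gt0) // ltW.
  - by rewrite ler_wpM2l ?exprn_ge0.
  - by rewrite -natrX ler_nat.
rewrite [leRHS]exprMn mulrC; apply: ler_pM; rewrite ?exprn_ge0 //.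
  by rewrite mulr_ge0 // mulr_ge0 ?exprn_ge0 // ltW.
apply: (@le_trans _ _ (C ^+ r.-1)).
  rewrite ler_pXn2r // ?nnegrE ?(ltW C0) //.
    by move: a1; case: (r) => [|[]].
  by rewrite mulr_ge0 // mulr_ge0 ?exprn_ge0 // ltW.
by rewrite ler_weXn2l // leq_pred.
Qed.

(** A union bound over [m] in one statistic: if it is below 1, so is every term, and every count is
    below [6 * r * #|msupp m|]. When [z ^+ r = s], the factor [z ^+ (6 * r) = n%:R ^+ 3] per support
    vertex outweighs its [n] positions and [n] values. The zero vector is left out because its term
    would be 1. *)
Definition sparse_stat (k : nat) (z theta : R) (H : {set {set 'I_n}}) : R :=
  \sum_(m | (msupp m != finset.set0) && (mass m <= k * n)%N)
    z ^+ #|[set e in H | heavy theta m e]%SET| / z ^+ (6 * r * #|msupp m|).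

Lemma sparse_statP k z theta H m : 1 < z -> 0 < theta ->
  H \in hypergraphs r n -> sparse_stat k z theta H < 1 -> (mass m <= k * n)%N ->
  #|[set e in H | heavy theta m e]%SET|%:R <= (6 * r)%:R * #|msupp m|%:R :> R.
Proof.
move=> z1 th0 HE st mk; rewrite -natrM ler_nat.
have z0 : 0 < z by apply: lt_trans z1.
case: (eqVneq (msupp m) finset.set0) => [m0|m0].
  apply: (@leq_trans (#|msupp m| ^ r)); last by rewrite m0 cards0 exp0n.
  apply: leq_trans (card_heavy_le_supp r m th0).
  apply/subset_leq_card/fintype.subsetP => e; rewrite !finset.in_set.
  move: HE; rewrite powersetE => /fintype.subsetP HE /andP[/HE].
  by rewrite finset.in_set => -> ->.
move: st; rewrite /sparse_stat (bigD1 m) /=; last by rewrite m0 mk.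
set S := \sum_(_ | _) _; have S0 : 0 <= S.
  by apply: sumr_ge0 => m' _; rewrite divr_ge0 ?exprn_ge0 // ltW.
move=> st; have : z ^+ #|[set e in H | heavy theta m e]%SET| /
  z ^+ (6 * r * #|msupp m|) < 1 by apply: le_lt_trans st; rewrite lerDl.
rewrite ltr_pdivrMr ?exprn_gt0 // mul1r.
by rewrite ltr_eXn2l // => /ltnW.
Qed.

(** Over all [m] the sum factors into [(1 + n * rho) ^+ n]; the subtracted 1 is the term of the zero
    vector. *)
Lemma sum_supp_le (rho : R) : 0 <= rho ->
  \sum_(m : {ffun 'I_n -> 'I_n.+1} | msupp m != finset.set0) rho ^+ #|msupp m| <=
  expR (n%:R * (n%:R * rho)) - 1.
Proof.
move=> rho0; pose m0 : {ffun 'I_n -> 'I_n.+1} := [ffun=> ord0].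
have mm0 m : (msupp m != finset.set0) = (m != m0).
  congr (~~ _); apply/eqP/eqP => [mE|->].
    apply/ffunP => v; rewrite ffunE; apply/val_inj => /=.
    have : v \notin msupp m by rewrite mE finset.in_set0.
    by rewrite finset.in_set negbK => /eqP.
  by apply/setP => v; rewrite finset.in_set finset.in_set0 ffunE.
rewrite lerBrDl; apply: (@le_trans _ _ (\sum_(m : {ffun 'I_n -> 'I_n.+1}) rho ^+ #|msupp m|)).
  rewrite [leRHS](bigD1 m0) //= lerD //.
    suff -> : msupp m0 = finset.set0 by rewrite cards0.
    by apply/eqP; rewrite -[_ == _]negbK mm0 eqxx.
  by rewrite le_eqVlt; apply/orP; left; apply/eqP/eq_bigl => m.
have E1 m : rho ^+ #|msupp m| = \prod_v (if m v == 0 :> nat then 1 else rho).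
  rewrite -prodr_const big_mkcond; apply: eq_bigr => v _.
  by rewrite finset.in_set; case: eqP.
under eq_bigr do rewrite E1.
rewrite -(bigA_distr_bigA (fun (v : 'I_n) (l : 'I_n.+1) =>
  if l == 0 :> nat then 1 else rho)) /=.
rewrite prodr_const card_ord big_ord_recl /= sumr_const card_ord.
rewrite expRM_natl ler_pXn2r ?nnegrE ?expR_ge0 //.
  by rewrite -[rho *+ n]mulr_natl expR_ge1Dx.
by rewrite addr_ge0 // mulrn_wge0.
Qed.

Lemma ER_expect_sparse_stat (c z C : R) (k : nat) :
  0 < c -> 1 <= z -> z ^+ r = s -> 1 <= C -> expR k%:R <= C * c ^+ 2 ->
  2 * expR C <= n%:R ->
  ER_expect r p (sparse_stat k z (c * p * n%:R ^+ r.-1)) <=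
  2 * expR C / n%:R.
Proof.
move=> c0 z1 zr C1 Cc nC; have z0 : 0 < z by apply: lt_le_trans z1.
rewrite ER_expect_sum.
(* Per support vertex, [expR C] bounds the exponential moment through [heavy_mean_le], and the cube
   is [z ^+ (6 * r)]. *)
pose rho := expR C / n%:R ^+ 3.
have rho0 : 0 <= rho by rewrite divr_ge0 ?expR_ge0 ?exprn_ge0.
apply: (@le_trans _ _ (\sum_(m : {ffun 'I_n -> 'I_n.+1} | msupp m != finset.set0) rho ^+ #|msupp m|)).
  rewrite big_mkcondr /=; apply: ler_sum => m _.
  case: ifP => mk; last by rewrite exprn_ge0.
  rewrite ER_expectZ ler_pdivrMr ?exprn_gt0 //.
  apply: (le_trans (ER_expect_count r p01
    (heavy (c * p * n%:R ^+ r.-1) m) z1)).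
  rewrite exprM mulnC exprM zr -[6%N]/(2 * 3)%N exprM s2 -exprMn.
  rewrite /rho divfK ?expf_neq0 ?gt_eqF // -expRM_natl ler_expR.
  by rewrite [_ * C]mulrC (@heavy_mean_le m c z C k) // ltW.
apply: (le_trans (sum_supp_le rho0)).
have -> : n%:R * (n%:R * rho) = expR C / n%:R.
  by rewrite /rho; field; rewrite gt_eqF.
set x := expR C / n%:R.
have x2 : x <= 2^-1 by rewrite /x ler_pdivrMr // mulrC; lra.
have x0 : 0 <= x by rewrite divr_ge0 ?expR_ge0.
have -> : 2 * expR C / n%:R = 2 * x by rewrite /x mulrA.
have := expR_le1DxX2 x2; have : x * x <= 2^-1 * x by rewrite ler_wpM2r.
by rewrite expr2; lra.
Qed.

(** The same device for codegrees. When [w ^+ 2 = s], [w ^+ (4 * r.+1) = n%:R ^+ r.+1] pays for the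
    choice of [f], and [expR (p * s ^+ r / w)] for the exponential moment. *)
Definition codegree_stat (w : R) (H : {set {set 'I_n}}) : R :=
  \sum_(f : {set 'I_n} | #|f| == r.-1)
    w ^+ #|[set e in H | f \subset e]%SET| /
    (w ^+ (4 * r.+1) * expR (p * s ^+ r / w)).

Lemma codegree_statP w (H : {set {set 'I_n}}) f : expR 1 <= w ->
  codegree_stat w H < 1 -> #|f| = r.-1 ->
  #|[set e in H | f \subset e]%SET|%:R <= (4 * r.+1)%:R + p * s ^+ r / w.
Proof.
move=> w1 st cf; have w0 : 0 < w by apply: lt_le_trans w1; rewrite expR_gt0.
move: st; rewrite /codegree_stat (bigD1 f) /=; last by rewrite cf.
set S := \sum_(_ | _) _; have S0 : 0 <= S.
  by apply: sumr_ge0 => f' _; rewrite divr_ge0 ?mulr_ge0 ?expR_ge0 ?exprn_ge0 // ltW.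
set N := #|_| => st.
have : w ^+ N / (w ^+ (4 * r.+1) * expR (p * s ^+ r / w)) < 1.
  by apply: le_lt_trans st; rewrite lerDl.
rewrite ltr_pdivrMr ?mulr_gt0 ?expR_gt0 ?exprn_gt0 // mul1r => h.
have q0 : 0 <= p * s ^+ r / w by rewrite divr_ge0 ?(ltW w0) // (le_trans _ q_ge1).
case: (leqP N (4 * r.+1)) => NB; first by rewrite -[leLHS]addr0 lerD // ler_nat.
(* As [w >= expR 1], the excess of [N] over [4 * r.+1] is at most the exponent [p * s ^+ r / w]. *)
move: h; rewrite -(subnKC (ltnW NB)) exprD ltr_pM2l ?exprn_gt0 // natrD lerD2l.
move=> h; rewrite -ler_expR -[_%:R]mulr1 expRM_natl; apply/ltW.
apply: le_lt_trans h; apply: lerXn2r; rewrite ?nnegrE ?expR_ge0 //.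
exact: ltW.
Qed.

Lemma ER_expect_codegree_stat w : expR 1 <= w -> w ^+ 2 = s ->
  ER_expect r p (codegree_stat w) <= n%:R^-1.
Proof.
move=> we ws; have w0 : 0 < w by apply: lt_le_trans we; rewrite expR_gt0.
have w1 : 1 <= w by have := expR_ge1Dx (1 : R); lra.
rewrite ER_expect_sum.
apply: (@le_trans _ _ (\sum_(f : {set 'I_n} | #|f| == r.-1) (n%:R ^+ r.+1)^-1)).
  apply: ler_sum => f /eqP cf; rewrite ER_expectZ.
  rewrite ler_pdivrMr ?mulr_gt0 ?exprn_gt0 ?expR_gt0 //.
  rewrite -[(4 * _)%N]/(2 * 2 * _)%N exprM exprM ws s2 mulrA mulVf ?mul1r; last first.
    by rewrite expf_neq0 ?gt_eqF.
  apply: (le_trans (ER_expect_count r p01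
    (fun e => f \subset e) w1)); rewrite ler_expR.
  rewrite ler_pdivlMr //; set N := #|_|.
  have -> : p * w * N%:R * w = p * (w ^+ 2 * N%:R) by ring.
  rewrite ws ler_wpM2l ?(ltW p_gt0) //.
  (* At most [n] candidate edges contain [f], and [s * n%:R = s ^+ 3 <= s ^+ r] as [3 <= r]. *)
  apply: (@le_trans _ _ (s * n%:R)).
    by rewrite ler_wpM2l ?(ltW s_gt0) // ler_nat card_codegree_le.
  by rewrite -s2 -exprS ler_weXn2l.
rewrite sumr_const -[leLHS]mulr_natl ler_pdivrMr ?exprn_gt0 //.
rewrite exprS mulrA mulVf ?mul1r ?gt_eqF // -natrX ler_nat.
apply: (@leq_trans (n ^ r.-1)); last by rewrite leq_pexp2l // leq_pred.
have := @card_draws_le 'I_n [set: 'I_n]%SET r.-1; rewrite cardsT card_ord.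
apply: leq_trans; rewrite -cardsE; apply/subset_leq_card/fintype.subsetP => f.
by rewrite !finset.in_set finset.subsetT.
Qed.

End SparseStatistics.

(** * Light edges: the net and the Bernstein bound *)

Section LightEdges.
Variables (R : realType) (r n : nat) (p s tau : R).
Hypotheses (p01 : 0 <= p <= 1) (s_gt0 : 0 < s) (s2 : s ^+ 2 = n%:R).
Hypotheses (tau_gt0 : 0 < tau) (n_gt0 : (0 < n)%N).
Local Notation E := (hyperedges r n).
Implicit Types (K : {ffun 'I_r * 'I_n -> bool * 'I_n.+1}) (e : {set 'I_n}).

(* A net for [r]-tuples of unit vectors: sign and magnitude, in units of [1/s],
   of each coordinate. *)
Definition grid_vec K (j : 'I_r) : 'rV[R]_n :=
  \row_k ((-1) ^+ (K (j, k)).1 * (K (j, k)).2%:R / s).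
Definition grid_max K : {ffun 'I_n -> 'I_n.+1} :=
  [ffun v => inord (\max_(j < r) (K (j, v)).2)].
(** The bound that rounding unit vectors yields: a coordinate [t] gets a magnitude at most
    [|t| * s + 1], with square at most [2 * n * t ^ 2 + 2], and this is summed over [r * n]
    coordinates. *)
Definition in_net K := (\sum_c (K c).2 ^ 2 <= 4 * r * n)%N.
Definition grid_weight K e : R := \prod_(v in e) ((grid_max K v)%:R / s).

Lemma grid_maxE K v : grid_max K v = \max_(j < r) (K (j, v)).2 :> nat.
Proof.
rewrite ffunE inordK // ltnS; apply/bigmax_leqP => j _.
by rewrite -ltnS.
Qed.

Lemma grid_vec_le K j v : `|grid_vec K j ord0 v| <= (grid_max K v)%:R / s.
Proof.
rewrite mxE -mulrA normrM normrX normrN1 expr1n mul1r ger0_norm; last first.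
  by rewrite divr_ge0 // ltW.
rewrite ler_wpM2r ?invr_ge0 ?(ltW s_gt0) // ler_nat grid_maxE.
exact: (@leq_bigmax _ (fun j : 'I_r => nat_of_ord (K (j, v)).2)).
Qed.

Lemma mass_grid_max K : in_net K -> (mass (grid_max K) <= 4 * r * n)%N.
Proof.
apply: leq_trans.
have -> : (\sum_c (K c).2 ^ 2 = \sum_(j < r) \sum_(v < n) (K (j, v)).2 ^ 2)%N.
  by rewrite pair_bigA /=; apply: eq_bigr => -[].
rewrite exchange_big /=; apply: leq_sum => v _; rewrite grid_maxE.
elim/big_rec2: _ => // j b a _ h.
case: (leqP (K (j, v)).2 b) => _; first exact: leq_trans h (leq_addl _ _).
exact: leq_addr.
Qed.

(** On the net, the product over coordinates of [16 / 2 ^+ (l ^ 2)] is at least 1. Summed over all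
    [K] it factors, and one coordinate gives at most 2 signs times 16 times a series bounded by
    2. *)
Lemma card_net : #|[set K | in_net K]%SET|%:R <= 64 ^+ (r * n) :> R.
Proof.
rewrite -sum1_card natr_sum.
pose g (l : bool * 'I_n.+1) : R := 16 / 2 ^+ (l.2 ^ 2).
have g0 l : 0 <= g l by rewrite divr_ge0 // exprn_ge0.
apply: (@le_trans _ _ (\sum_(K : {ffun 'I_r * 'I_n -> bool * 'I_n.+1}) \prod_c g (K c))).
  rewrite big_mkcond; apply: ler_sum => K _; rewrite finset.in_set.
  case: ifP => [KN|_]; last exact: prodr_ge0.
  rewrite big_split /= prodr_const card_prod !card_ord prodfV.
  rewrite -expr_sum ler_pdivlMr ?exprn_gt0 // mul1r.
  by rewrite -[16]/(16%:R) -[16%N]/(2 ^ 4)%N natrX -exprM ler_weXn2l ?ler1n // mulnA.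
rewrite -(bigA_distr_bigA (fun _ => g)) /= prodr_const card_prod !card_ord.
apply: lerXn2r; rewrite ?nnegrE ?sumr_ge0 //.
have -> : \sum_l g l = \sum_(b : bool) \sum_(l < n.+1) g (b, l).
  by rewrite pair_bigA /=; apply: eq_bigr => -[].
rewrite big_bool /g /=.
have geo N : \sum_(l < N) (2 ^+ (l ^ 2))^-1 <= 2 - (2 ^+ N)^-1 * 2 :> R.
  elim: N => [|N IH]; first by rewrite big_ord0; lra.
  rewrite big_ord_recr /=.
  have : (2 ^+ (N ^ 2))^-1 <= (2 ^+ N)^-1 :> R.
    rewrite lef_pV2 ?posrE ?exprn_gt0 // ler_weXn2l ?ler1n //.
    by case: (N) => // N'; rewrite -{1}[N'.+1]expn1 leq_pexp2l.
  move: IH; rewrite [2 ^+ N.+1]exprS invfM; lra.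
rewrite -mulr_sumr; have := geo n.+1.
have : 0 <= (2 ^+ n.+1)^-1 :> R by rewrite invr_ge0 exprn_ge0.
set S := \sum_(l < n.+1) _; lra.
Qed.

Definition light_coef K e : R :=
  if grid_weight K e < tau then edge_coef (grid_vec K) e else 0.

Definition light_sum K (H : {set {set 'I_n}}) : R :=
  \sum_(e in E) ((e \in H)%:R - p) * light_coef K e.

Definition light_stat (L : R) (H : {set {set 'I_n}}) : R :=
  \sum_(K | in_net K)
    (expR (light_sum K H / (2 * (r`!)%:R * tau)) +
     expR (- (light_sum K H / (2 * (r`!)%:R * tau)))) / expR L.

Let M_gt0 : 0 < 2 * (r`!)%:R * tau.
Proof. by rewrite !mulr_gt0 // ltr0n fact_gt0. Qed.

Lemma light_statP L H K : light_stat L H < 1 -> in_net K ->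
  `|light_sum K H| <= 2 * (r`!)%:R * tau * L.
Proof.
move=> st KN; move: st; rewrite /light_stat (bigD1 K) //=.
set S := \sum_(_ | _) _; have S0 : 0 <= S.
  by apply: sumr_ge0 => K' _; rewrite divr_ge0 ?addr_ge0 ?expR_ge0.
set u := light_sum K H / _ => st.
have : (expR u + expR (- u)) / expR L < 1 by apply: le_lt_trans st; rewrite lerDl.
rewrite ltr_pdivrMr ?expR_gt0 // mul1r => h.
have h1 : u <= L.
  by rewrite -ler_expR; apply: le_trans (ltW h); rewrite lerDl expR_ge0.
have h2 : - u <= L.
  by rewrite -ler_expR; apply: le_trans (ltW h); rewrite lerDr expR_ge0.
have -> : light_sum K H = 2 * (r`!)%:R * tau * u.
  by rewrite /u mulrC divfK // gt_eqF.
by rewrite normrM (gtr0_norm M_gt0) ler_pM2l // ler_norml h1 andbT lerNl.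
Qed.

Lemma light_coef_le K e : e \in E ->
  `|light_coef K e| <= (r`!)%:R * grid_weight K e.
Proof.
move=> eE; have Y0 : 0 <= grid_weight K e.
  by apply: prodr_ge0 => v _; rewrite divr_ge0 // ltW.
rewrite /light_coef; case: ifP => _; last by rewrite normr0 mulr_ge0.
by apply: edge_coef_le => // j v; apply: grid_vec_le.
Qed.

Lemma light_coef_le_tau K e : e \in E -> `|light_coef K e| <= (r`!)%:R * tau.
Proof.
move=> eE; case: (ltP (grid_weight K e) tau) => Yt.
  by apply: (le_trans (light_coef_le _ eE)); rewrite ler_wpM2l // ltW.
by rewrite /light_coef ltNge Yt normr0 mulr_ge0 // ltW.
Qed.

Lemma sum_grid_weight_sqr K (P : pred {set 'I_n}) : in_net K ->
  \sum_(e | P e) grid_weight K e ^+ 2 <= expR (4 * r)%:R.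
Proof.
move=> KN; apply: (le_trans (sum_sqr_prod_le (fun v => (grid_max K v)%:R / s) P)).
by rewrite ler_expR; apply: mass_sum_sqr => //; apply: mass_grid_max.
Qed.

(** The squared normalised coefficients sum to at most [expR (4 * r)%:R / (4 * tau ^+ 2)], so the
    assumption on [tau] is exactly that the Bernstein exponent is at most [n]. *)
Lemma ER_expect_light_sum K (sg : bool) : in_net K ->
  p * expR (4 * r)%:R <= 2 * tau ^+ 2 * n%:R ->
  ER_expect r p (fun H =>
    expR ((-1) ^+ sg * (light_sum K H / (2 * (r`!)%:R * tau)))) <= expR n%:R.
Proof.
move=> KN ptau; case/andP: (p01) => p0 _.
pose g e := (-1) ^+ sg * light_coef K e / (2 * (r`!)%:R * tau).
have f0 : 0 < (r`!)%:R :> R by rewrite ltr0n fact_gt0.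
rewrite (@eq_ER_expect _ _ _ _ _
    (fun H => expR (\sum_(e in E) ((e \in H)%:R - p) * g e))); last first.
  move=> H _; congr expR; rewrite mulrCA mulr_suml.
  by apply: eq_bigr => e _; rewrite /g; ring.
have gn e : `|g e| = `|light_coef K e| / (2 * (r`!)%:R * tau).
  by rewrite /g !normrM normrX normrN1 expr1n mul1r normfV (gtr0_norm M_gt0).
apply: (le_trans (ER_expect_expR p01 _)).
  move=> e eE; apply: (le_trans (ler_norm _)); rewrite gn ler_pdivrMr //.
  by apply: (le_trans (light_coef_le_tau _ eE)); lra.
rewrite ler_expR.
have : \sum_(e in E) g e ^+ 2 <= expR (4 * r)%:R / (4 * tau ^+ 2).
  apply: le_trans (_ : _ <= (\sum_(e in E) grid_weight K e ^+ 2) / (4 * tau ^+ 2)) _.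
    rewrite mulr_suml; apply: ler_sum => e eE.
    rewrite -[g e ^+ 2]ger0_norm ?sqr_ge0 // normrX gn expr_div_n.
    have -> : (2 * (r`!)%:R * tau) ^+ 2 = (r`!)%:R ^+ 2 * (4 * tau ^+ 2) :> R by ring.
    rewrite [in leLHS]invfM mulrA ler_wpM2r ?invr_ge0 ?mulr_ge0 ?(ltW tau_gt0) //.
    rewrite ler_pdivrMr ?exprn_gt0 // mulrC -exprMn ler_pXn2r ?nnegrE //.
      exact: light_coef_le.
    by apply: (le_trans (normr_ge0 _) (light_coef_le K eE)).
  rewrite ler_wpM2r ?invr_ge0 ?mulr_ge0 ?(ltW tau_gt0) //.
  exact: sum_grid_weight_sqr.
move=> h; apply: (@le_trans _ _ (2 * p * (expR (4 * r)%:R / (4 * tau ^+ 2)))).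
  by rewrite ler_wpM2l // mulr_ge0.
rewrite mulrA ler_pdivrMr ?mulr_gt0 ?exprn_gt0 //.
move: ptau; set a := expR _; set t2 := tau ^+ 2; lra.
Qed.

Lemma ER_expect_light_stat L :
  p * expR (4 * r)%:R <= 2 * tau ^+ 2 * n%:R ->
  ER_expect r p (light_stat L) <= 64 ^+ (r * n) * (2 * expR n%:R / expR L).
Proof.
move=> ptau; rewrite ER_expect_sum.
apply: (@le_trans _ _ (\sum_(K | in_net K) (2 * expR n%:R / expR L))).
  apply: ler_sum => K KN; rewrite ER_expectZ ler_wpM2r ?invr_ge0 ?expR_ge0 //.
  rewrite ER_expectD.
  have := ER_expect_light_sum false KN ptau.
  have := ER_expect_light_sum true KN ptau.
  under eq_ER_expect do rewrite expr1 mulN1r.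
  move=> h1; under eq_ER_expect do rewrite expr0 mul1r.
  by move: h1; lra.
rewrite sumr_const -[leLHS]mulr_natl ler_wpM2r ?divr_ge0 ?mulr_ge0 ?expR_ge0 //.
by apply: le_trans card_net; rewrite -cardsE.
Qed.

End LightEdges.

(** * Combining light and heavy edges at grid points *)

Lemma grid_inner_le (R : realType) (r n : nat) (p s tau z w L : R) H
    (K : {ffun 'I_r * 'I_n -> bool * 'I_n.+1}) :
  0 <= p <= 1 -> 1 <= s -> s ^+ 2 = n%:R -> (3 <= r)%N -> 1 <= p * s ^+ r ->
  0 < tau -> 1 < z -> expR 1 <= w -> H \in hypergraphs r n -> in_net K ->
  sparse_stat r (4 * r) z (tau * s ^+ r) H < 1 ->
  codegree_stat r p s w H < 1 -> light_stat r p s tau L H < 1 ->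
  `|tensor_inner (adj_tensor R r H - mean_tensor r n p)
      (rank_one (grid_vec s K))| <=
  2 * (r`!)%:R * tau * L + (r`!)%:R *
    ((6 * r)%:R * (4 * r)%:R +
     ((4 * r.+1)%:R + p * s ^+ r / w) * expR (4 * r)%:R +
     p * expR (4 * r)%:R / tau).
Proof.
move=> p01 s1 s2 r3 q1 t0 z1 w1 HE KN st1 st2 st3.
have s0 : 0 < s by apply: lt_le_trans s1.
have r0 : (0 < r)%N by apply: ltn_trans r3.
have w0 : 0 < w by apply: lt_le_trans w1; rewrite expR_gt0.
have n0 : (0 < n)%N by rewrite -(ltr0n R) -s2 exprn_gt0.
have sr0 : 0 < s ^+ r by rewrite exprn_gt0.
case/andP: (p01) => p0 p1.
have Y0 e : 0 <= grid_weight s K e.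
  by apply: prodr_ge0 => v _; rewrite divr_ge0 // ltW.
have heavyE e : e \in hyperedges r n ->
    heavy (tau * s ^+ r) (grid_max K) e = (tau <= grid_weight s K e).
  rewrite finset.in_set => /eqP ce.
  rewrite /grid_weight big_split /= prodr_const ce exprVn.
  by rewrite ler_pdivlMr.
have HsubE e : e \in H -> e \in hyperedges r n.
  by move: HE; rewrite powersetE => /fintype.subsetP; apply.
rewrite centered_inner //.
(* The heavy part is bounded without cancellation: hyperedges of [H] are summed with weight 1 and
   the mean with weight [p]. *)
pose hc e := if tau <= grid_weight s K e then edge_coef (grid_vec s K) e else 0.
have -> : \sum_(e in hyperedges r n) ((e \in H)%:R - p) * edge_coef (grid_vec s K) e
  = light_sum p s tau K H + \sum_(e in hyperedges r n) ((e \in H)%:R - p) * hc e.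
  rewrite -big_split; apply: eq_bigr => e _; rewrite /= -mulrDr; congr (_ * _).
  by rewrite /light_coef /hc; case: ltP; rewrite ?addr0 ?add0r.
apply: (le_trans (ler_normD _ _)); apply: lerD; first exact: light_statP.
pose f : R := (r`!)%:R; have f0 : 0 <= f by [].
apply: (@le_trans _ _ (f * (\sum_(e in H | heavy (tau * s ^+ r) (grid_max K) e)
   grid_weight s K e + p * \sum_(e in hyperedges r n | tau <= grid_weight s K e)
   grid_weight s K e))).
  apply: (le_trans (ler_norm_sum _ _ _)).
  rewrite mulrDr !mulr_sumr big_mkcond [X in _ <= X + _]big_mkcond.
  rewrite [X in _ <= _ + X]big_mkcond -big_split /=; apply: ler_sum => e _.
  case: (boolP (e \in hyperedges r n)) => eE /=; last first.
    by case: (boolP (e \in H)) => [/HsubE|_ /=]; rewrite ?(negPf eE) ?addr0.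
  rewrite heavyE // /hc; case: ifP => tY; last first.
    by rewrite mulr0 normr0 andbF addr0.
  rewrite normrM andbT.
  have -> : (if e \in H then f * grid_weight s K e else 0) +
    f * (p * grid_weight s K e) = ((e \in H)%:R + p) * (f * grid_weight s K e).
    by case: (e \in H) => /=; ring.
  apply: ler_pM => //.
    by apply: (le_trans (ler_normB _ _)); rewrite !ger0_norm.
  by apply: edge_coef_le => // j v; apply: grid_vec_le.
rewrite ler_wpM2l // lerD //.
  have th0 : 0 < tau * s ^+ r by rewrite mulr_gt0.
  apply: (heavy_sum_le s0 s2 r0 n0 th0 HE _ _ (mass_grid_max KN)) => //.
  - by rewrite addr_ge0 // divr_ge0 ?mulr_ge0 // ltW.
  - move=> m' m'le; apply: sparse_statP st1 _ => //.
    exact: leq_trans m'le (mass_grid_max KN).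
  - by move=> f' cf'; apply: codegree_statP.
(* For the mean, a weight [Y >= tau] satisfies [Y <= Y ^+ 2 / tau], and the squares are summable. *)
rewrite -mulrA ler_wpM2l // ler_pdivlMr // mulr_suml.
apply: le_trans (sum_grid_weight_sqr s2 n0
  (fun e => (e \in hyperedges r n) && (tau <= grid_weight s K e)) KN).
by apply: ler_sum => e /andP[_ tY]; rewrite expr2 ler_wpM2l.
Qed.

Lemma exists_grid (R : realType) (r n : nat) (s : R) (A : tensor R r n)
    (x : 'I_r -> 'rV[R]_n) :
  2 <= s -> s ^+ 2 = n%:R -> (forall j, l2norm (x j) = 1) ->
  exists K : {ffun 'I_r * 'I_n -> bool * 'I_n.+1}, in_net K /\
  `|tensor_inner A (rank_one x)| <= `|tensor_inner A (rank_one (grid_vec s K))|.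
Proof.
move=> s2' s2 x1; have s0 : 0 < s by apply: lt_le_trans s2'.
have [K [K1 K2]] := tensor_inner_round A x s0.
(* Magnitudes fit in ['I_n.+1] because [s + 1 <= s ^+ 2 = n%:R] for [2 <= s]. *)
have Kn c : ((K c).2 < n.+1)%N.
  case: c => j k; rewrite ltnS -(ler_nat R) -s2; apply: (le_trans (K1 j k)).
  apply: (@le_trans _ _ (s + 1)); last by rewrite expr2; nra.
  by rewrite lerD2r ler_piMl ?(ltW s0) // l2norm1_coord.
exists [ffun c => ((K c).1, Ordinal (Kn c))]; split; last first.
  apply: (le_trans K2); rewrite le_eqVlt; apply/orP; left; apply/eqP.
  congr (`| _ |); apply: eq_bigr => i _; rewrite !ffunE; congr (_ * _).
  by apply: eq_bigr => j _; rewrite !mxE !ffunE.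
rewrite /in_net -(ler_nat R) natr_sum.
apply: (@le_trans _ _ (\sum_(c : 'I_r * 'I_n) (2 * s ^+ 2 * x c.1 ord0 c.2 ^+ 2 + 2))).
  apply: ler_sum => -[j k] _; rewrite ffunE /= natrX.
  apply: (@le_trans _ _ ((`|x j ord0 k| * s + 1) ^+ 2)).
    by apply: lerXn2r; rewrite ?nnegrE ?addr_ge0 ?mulr_ge0 // ltW.
  rewrite -[x j ord0 k ^+ 2]ger0_norm ?sqr_ge0 // normrX.
  have := sqr_ge0 (`|x j ord0 k| * s - 1); set a := `|_|; rewrite !expr2; lra.
rewrite big_split /= -mulr_sumr.
have -> : \sum_(c : 'I_r * 'I_n) x c.1 ord0 c.2 ^+ 2 = r%:R.
  rewrite -(pair_bigA _ (fun j k => x j ord0 k ^+ 2)) /=.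
  rewrite (eq_bigr (fun=> 1)) ?sumr_const ?card_ord // => j _.
  exact: l2norm1_sum.
rewrite sumr_const card_prod !card_ord s2 -[2 *+ _]mulr_natr !natrM; lra.
Qed.

(** * The injective norm of the mean tensor *)

Section MeanTensor.
Variables (R : realType) (r n : nat) (p s : R).
Hypotheses (p_ge0 : 0 <= p) (s_gt0 : 0 < s) (s2 : s ^+ 2 = n%:R).

Let n_gt0 : (0 < n)%N. Proof. by rewrite -(ltr0n R) -s2 exprn_gt0. Qed.

(** All entries lie between 0 and [p], so the form is at most [p] times the product of the l1 norms,
    each at most [s] for a unit vector. *)
Lemma inj_norm_mean_le : inj_norm (mean_tensor r n p) <= p * s ^+ r.
Proof.
apply: inj_norm_le => // x x1.
apply: (@le_trans _ _ (p * \sum_(i : r.-tuple 'I_n)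
  \prod_(j < r) `|x j ord0 (tnth i j)|)).
  apply: (le_trans (ler_norm_sum _ _ _)); rewrite mulr_sumr.
  apply: ler_sum => i _; rewrite normrM mean_tensorE ffunE normr_prod.
  rewrite ler_wpM2r ?prodr_ge0 //; case: ifP => _; last by rewrite normr0.
  by rewrite ger0_norm.
rewrite ler_wpM2l // (sum_tuple_prod (fun j k => `|x j ord0 k|)).
have -> : s ^+ r = \prod_(j < r) s by rewrite prodr_const card_ord.
apply: ler_prod => j _.
apply/andP; split; first by apply: sumr_ge0.
(* The arithmetic-geometric mean inequality, balanced so that both halves sum to [s / 2]. *)
apply: (@le_trans _ _ (\sum_(k < n) (s * x j ord0 k ^+ 2 + s^-1) / 2)).
  apply: ler_sum => k _; rewrite -[x j ord0 k ^+ 2]ger0_norm ?sqr_ge0 // normrX.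
  set a := `|_|; rewrite ler_pdivlMr // -subr_ge0.
  have -> : s * a ^+ 2 + s^-1 - a * 2 = (s * a - 1) ^+ 2 / s.
    by field; rewrite gt_eqF.
  by rewrite divr_ge0 ?sqr_ge0 // ltW.
rewrite -mulr_suml big_split /= -mulr_sumr l2norm1_sum // sumr_const card_ord.
rewrite -[s^-1 *+ n]mulr_natr -s2 expr2 mulrA mulVf ?gt_eqF // mul1r; lra.
Qed.

Lemma ffact_ge k : ((n - k) ^ k <= n ^_ k)%N.
Proof.
suff : forall j, (j <= k)%N -> ((n - k) ^ j <= n ^_ j)%N by apply.
elim=> // j IH jk; rewrite expnSr ffactnSr.
by apply: leq_mul; [exact: IH (ltnW jk) | exact: leq_sub2l (ltnW jk)].
Qed.

Lemma bernoulli_le (x : R) k : 0 <= x <= 1 -> 1 - k%:R * x <= (1 - x) ^+ k.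
Proof.
move=> /andP[x0 x1]; elim: k => [|k IH]; first by rewrite mul0r subr0.
rewrite exprS; apply: (@le_trans _ _ ((1 - x) * (1 - k%:R * x))).
  have : 0 <= k%:R * x * x by rewrite !mulr_ge0.
  by rewrite -natr1; lra.
by rewrite ler_wpM2l // subr_ge0.
Qed.

(** Tested on the constant unit vectors: only multi-indices with distinct entries count, a share
    [n ^_ r / n ^ r] of all, and Bernoulli's inequality bounds this share below. *)
Lemma inj_norm_mean_ge : (r <= n)%N ->
  p * s ^+ r * (1 - r%:R ^+ 2 / n%:R) <= inj_norm (mean_tensor r n p).
Proof.
move=> rn; have nR : 0 < n%:R :> R by rewrite ltr0n.
pose x (j : 'I_r) : 'rV[R]_n := const_mx (Num.sqrt n%:R)^-1.
have x1 j : l2norm (x j) = 1 by apply: l2norm_const.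
apply: le_trans (inj_norm_ge (mean_tensor r n p) x1).
apply: le_trans (ler_norm _).
have sE : Num.sqrt n%:R = s by rewrite -s2 sqrtr_sqr gtr0_norm.
have -> : tensor_inner (mean_tensor r n p) (rank_one x) =
    (n ^_ r)%:R * (p / s ^+ r).
  rewrite /tensor_inner (eq_bigr (fun i : r.-tuple 'I_n =>
      if uniq i then p / s ^+ r else 0)).
    rewrite -big_mkcond sumr_const -[LHS]mulr_natl; congr (_%:R * _).
    rewrite -[in RHS](card_ord n) -card_uniq_tuples -cardsE.
    apply: eq_card => i; rewrite !finset.in_set.
    by have /allP -> : forall k, k \in i -> 'I_n k by [].
  move=> i _; rewrite mean_tensorE ffunE.
  have -> : ([set k in i]%SET \in hyperedges r n) = uniq i.
    rewrite finset.in_set cardsE -{2}(size_tuple i).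
    by apply/eqP/card_uniqP.
  case: ifP => _; last by rewrite mul0r.
  congr (_ * _); under eq_bigr do rewrite mxE sE.
  by rewrite prodr_const card_ord exprVn.
have nE : n%:R ^+ r = s ^+ r * s ^+ r :> R by rewrite -s2 -exprM mulnC exprM expr2.
have -> : p * s ^+ r * (1 - r%:R ^+ 2 / n%:R) =
   (n%:R ^+ r * (1 - r%:R * (r%:R / n%:R))) * (p / s ^+ r).
  by rewrite nE; field; rewrite !gt_eqF // exprn_gt0.
rewrite ler_wpM2r ?divr_ge0 ?exprn_ge0 ?(ltW s_gt0) //.
apply: (@le_trans _ _ ((n - r)%:R ^+ r)); last by rewrite -natrX ler_nat ffact_ge.
have -> : (n - r)%:R = n%:R * (1 - r%:R / n%:R) :> R.
  by rewrite natrB //; field; rewrite gt_eqF.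
rewrite exprMn ler_wpM2l ?exprn_ge0 // bernoulli_le //.
by rewrite divr_ge0 //= ler_pdivrMr // mul1r ler_nat.
Qed.

End MeanTensor.

(** * Choice of constants and the bound on the centered tensor *)

Lemma ER_centered_norm (R : realType) (r : nat) (eps : R) :
  (3 <= r)%N -> 0 < eps ->
  exists Q S B : R, forall (n : nat) (p s : R),
    0 <= p <= 1 -> s ^+ 2 = n%:R -> S <= s -> Q <= p * s ^+ r ->
    exists F : {set {set 'I_n}} -> R,
    [/\ forall H, 0 <= F H, ER_expect r p F <= B / n%:R &
        forall H, H \in hypergraphs r n -> F H < 1 ->
        inj_norm (adj_tensor R r H - mean_tensor r n p) <=
        3 * eps * (p * s ^+ r)].
Proof.
move=> r3 eps0.
pose f : R := (r`!)%:R.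
have f0 : 0 < f by rewrite ltr0n fact_gt0.
(* The net costs [64 ^+ (r * n) <= expR (6 * r * n)] and the moment [expR n]; the last [n] in
   [L * n] leaves a failure term [2 / expR n]. *)
pose L : R := 6 * r%:R + 2.
have L0 : 0 < L by rewrite /L; have : 0 <= r%:R :> R by []; lra.
(* With [tau = c * q / n], this makes the light contribution exactly [eps * q]. *)
pose c := eps / (2 * f * L).
have c0 : 0 < c by rewrite divr_gt0 // !mulr_gt0.
pose a : R := expR (4 * r)%:R.
have a0 : 0 < a by rewrite expR_gt0.
pose C := 1 + a / c ^+ 2.
have c20 : 0 < c ^+ 2 by rewrite exprn_gt0.
have ac0 : 0 < a / c ^+ 2 by rewrite divr_gt0.
have C1 : 1 <= C by rewrite /C; lra.
(* [D] collects the terms that stay bounded, while [W <= w] makes the codegree term [f * a * q / w]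
   at most [eps * q]; with the light part this gives the factor 3. *)
pose D := f * ((6 * r)%:R * (4 * r)%:R + (4 * r.+1)%:R * a + a / c).
pose W := expR 1 + f * a / eps.
have W0 : 0 < W by rewrite /W addr_gt0 ?expR_gt0 ?divr_gt0 ?mulr_gt0.
(* [Q] gives [1 <= q] and [D <= eps * q]. The summands of [S] give [2 <= s], [2 * expR C <= n],
   [a <= c ^+ 2 * s] and [W <= Num.sqrt s]. The third constant adds the expectations
   [2 * expR C / n], [1 / n] and [2 / n]. *)
exists (1 + D / eps), (2 + 2 * expR C + C + W ^+ 2), (2 * expR C + 3).
move=> n p s p01 s2 sS qQ.
case/andP: (p01) => p0 p1.
have eC0 : 0 < expR C by rewrite expR_gt0.
have W20 : 0 < W ^+ 2 by rewrite exprn_gt0.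
have s2' : 2 <= s by lra.
have s1 : 1 <= s by lra.
have s0 : 0 < s by lra.
have D0 : 0 <= D by rewrite !(mulr_ge0, addr_ge0, invr_ge0) // ltW.
have De0 : 0 <= D / eps by rewrite divr_ge0 // ltW.
have q1 : 1 <= p * s ^+ r by lra.
have DQ : D <= eps * (p * s ^+ r).
  by rewrite mulrC -ler_pdivrMr //; lra.
have nR : 0 < n%:R :> R by rewrite -s2 exprn_gt0.
have n0 : (0 < n)%N by rewrite -(ltr0n R).
have sn : s <= n%:R by rewrite -s2 -[leLHS]expr1 ler_weXn2l.
have sr0 : 0 < s ^+ r by rewrite exprn_gt0.
have r0 : (0 < r)%N by apply: ltn_trans r3.
pose q := p * s ^+ r.
have q0 : 0 < q by rewrite (lt_le_trans _ q1).
have pgt0 : 0 < p by move: q0; rewrite pmulr_lgt0.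
pose tau := c * q / n%:R.
have t0 : 0 < tau by rewrite divr_gt0 // mulr_gt0.
pose z := s `^ (r%:R^-1).
have zr : z ^+ r = s.
  rewrite -powR_mulrn ?powR_ge0 // -powRrM mulVf ?powRr1 ?(ltW s0) //.
  by rewrite pnatr_eq0 -lt0n.
have z1 : 1 < z.
  rewrite ltNge; apply/negP => zle.
  have : z ^+ r <= 1 by rewrite exprn_ile1 // powR_ge0.
  by rewrite zr; lra.
pose w := Num.sqrt s.
have ws : w ^+ 2 = s by rewrite sqr_sqrtr // ltW.
have wW : W <= w.
  rewrite -[W](ger0_norm (ltW W0)) -sqrtr_sqr ler_wsqrtr //; lra.
have faw0 : 0 <= f * a / eps by rewrite divr_ge0 ?mulr_ge0 ?ltW.
have we : expR 1 <= w by apply: le_trans wW; rewrite /W lerDl.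
have w0 : 0 < w by apply: lt_le_trans wW.
have thE : tau * s ^+ r = c * p * n%:R ^+ r.-1.
  have nE : n%:R ^+ r.-1 = s ^+ r * s ^+ r / n%:R :> R.
    rewrite -[s ^+ r * s ^+ r]expr2 -exprM mulnC exprM s2.
    by rewrite -{2}(prednK r0) exprS mulrC mulKf // gt_eqF.
  by rewrite nE /tau /q; field; rewrite gt_eqF.
pose F (H : {set {set 'I_n}}) := sparse_stat r (4 * r) z (tau * s ^+ r) H + codegree_stat r p s w H +
  light_stat r p s tau (L * n%:R) H.
have F1 H : 0 <= sparse_stat r (4 * r) z (tau * s ^+ r) (H : {set {set 'I_n}}).
  by apply: sumr_ge0 => m _; rewrite divr_ge0 ?exprn_ge0 ?powR_ge0.
have F2 H : 0 <= codegree_stat r p s w (H : {set {set 'I_n}}).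
  by apply: sumr_ge0 => m _; rewrite divr_ge0 ?mulr_ge0 ?exprn_ge0 ?expR_ge0 // ltW.
have F3 H : 0 <= light_stat r p s tau (L * n%:R) (H : {set {set 'I_n}}).
  by apply: sumr_ge0 => m _; rewrite divr_ge0 ?addr_ge0 ?expR_ge0.
exists F; split=> [H||H HE FH].
- by rewrite /F !addr_ge0.
- rewrite /F 2!ER_expectD.
  have h1 : ER_expect r p (sparse_stat (n := n) r (4 * r) z (tau * s ^+ r)) <=
      2 * expR C / n%:R.
    have z1' := ltW z1; rewrite thE; apply: (ER_expect_sparse_stat p01 s1 s2 r3 q1 c0 z1' zr C1).
      by rewrite -/a /C mulrDl divfK ?gt_eqF // mul1r lerDr ltW.
    by apply: le_trans sn; lra.
  have h2 : ER_expect r p (codegree_stat (n := n) r p s w) <= n%:R^-1.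
    exact: ER_expect_codegree_stat.
  have h3 : ER_expect r p (light_stat (n := n) r p s tau (L * n%:R)) <= 2 / n%:R.
    have ptau : p * expR (4 * r)%:R <= 2 * tau ^+ 2 * n%:R.
      have sq : s <= q * s ^+ r / n%:R.
        rewrite ler_pdivlMr // -s2 -exprS -[leLHS]mul1r ler_pM ?exprn_ge0 ?(ltW s0) //.
        by rewrite ler_weXn2l.
      have -> : 2 * tau ^+ 2 * n%:R = p * (2 * c ^+ 2 * (q * s ^+ r / n%:R)).
        by rewrite /tau /q; field; rewrite gt_eqF.
      rewrite -/a ler_wpM2l //.
      apply: (@le_trans _ _ (c ^+ 2 * s)).
        by rewrite mulrC -ler_pdivrMr //; move: sS; rewrite /C; lra.
      have sX := ler_wpM2l (ltW c20) sq; apply: (le_trans sX).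
      have X0 := le_trans (ltW (mulr_gt0 c20 s0)) sX.
      by rewrite -[leRHS]mulrA ler_peMl // ler1n.
    apply: (le_trans (ER_expect_light_stat p01 s0 s2 t0 n0 (L * n%:R) ptau)).
    have e2 : 2 <= expR 1 :> R by have := expR_ge1Dx (1 : R); lra.
    have e64 : 64 ^+ (r * n) <= expR (6 * r%:R * n%:R) :> R.
      have -> : 6 * r%:R * n%:R = (6 * (r * n))%:R * 1 :> R.
        by rewrite !natrM mulr1 mulrA.
      rewrite expRM_natl [leRHS]exprM; apply: lerXn2r; rewrite ?nnegrE ?exprn_ge0 ?expR_ge0 //.
      have -> : 64 = 2 ^+ 6 :> R by ring.
      by apply: lerXn2r; rewrite ?nnegrE ?expR_ge0.
    apply: (@le_trans _ _ (expR (6 * r%:R * n%:R) *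
        (2 * expR n%:R / expR (L * n%:R)))).
      by rewrite ler_wpM2r // divr_ge0 ?mulr_ge0 ?expR_ge0.
    have -> : expR (6 * r%:R * n%:R) * (2 * expR n%:R / expR (L * n%:R)) =
        2 / expR n%:R :> R.
      have -> : L * n%:R = 6 * r%:R * n%:R + (n%:R + n%:R) by rewrite /L; ring.
      by rewrite !expRD; field; rewrite !gt_eqF ?expR_gt0.
    rewrite ler_wpM2l // lef_pV2 ?posrE ?expR_gt0 //.
    by apply: le_trans (expR_ge1Dx _); rewrite lerDr.
  have -> : (2 * expR C + 3) / n%:R = 2 * expR C / n%:R + n%:R^-1 + 2 / n%:R.
    by field; rewrite gt_eqF.
  by rewrite !lerD.
- move: FH; rewrite /F; have := F1 H; have := F2 H; have := F3 H => f3 f2 f1 FH.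
  apply: inj_norm_le => // x x1.
  have [K [KN Kx]] := exists_grid (adj_tensor R r H - mean_tensor r n p) s2' s2 x1.
  apply: (le_trans Kx).
  have st1 : sparse_stat r (4 * r) z (tau * s ^+ r) H < 1 by lra.
  have st2 : codegree_stat r p s w H < 1 by lra.
  have st3 : light_stat r p s tau (L * n%:R) H < 1 by lra.
  apply: (le_trans (grid_inner_le p01 s1 s2 r3 q1 t0 z1 we HE KN st1 st2 st3)).
  rewrite -/f -/q -/a.
  have -> : 2 * f * tau * (L * n%:R) = eps * q.
    by rewrite /tau /c; field; rewrite !gt_eqF.
  have e1 : f * a * (q / w) <= eps * q.
    have -> : f * a * (q / w) = q * (f * a / w) by ring.
    rewrite [eps * q]mulrC ler_wpM2l ?(ltW q0) // ler_pdivrMr //.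
    rewrite [eps * w]mulrC -ler_pdivrMr //.
    by apply: le_trans wW; rewrite /W lerDr expR_ge0.
  have e2 : p * a / tau <= a / c.
    have -> : p * a / tau = a / c * (n%:R / s ^+ r).
      by rewrite /tau /q; field; rewrite !gt_eqF.
    have ac : 0 <= a / c by rewrite divr_ge0 // ltW.
    rewrite ler_piMr //.
    rewrite ler_pdivrMr // mul1r -s2 ler_weXn2l //; exact: ltnW.
  have := ler_wpM2l (ltW f0) e2; move: DQ; rewrite -/q /D.
  move: e1; set b1 := (6 * r)%:R * _; set b2 := (4 * r.+1)%:R.
  set ac := a / c; set pat := p * a / tau; set qw := q / w.
  lra.
Qed.

(** * Passage to the limit *)

Unset Implicit Arguments.
Local Open Scope classical_set_scope.

Theorem theorem1p3 (R : realType) (r : nat) (p : nat -> R)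
    (r_ge3 : (3 <= r)%N)
    (p01 : forall n : nat, 0 <= p n <= 1)
    (p_large : (p n * n%:R `^ (r%:R / 2)) @[n --> \oo] --> +oo) :
  forall delta : R, 0 < delta ->
    ER_prob (p n) (fun T : tensor R r n =>
      `| inj_norm T - inj_norm (T - mean_tensor r n (p n))
         - p n * n%:R `^ (r%:R / 2) |
      <= delta * (p n * n%:R `^ (r%:R / 2)))
    @[n --> \oo] --> (1 : R).
Proof.
(* The lower bound uses [|T| - |T - M| >= |M| - 2 |T - M|] for injective norms: [|M|] loses
   [delta / 2], and twice [3 * (delta / 12)] is the other half. The upper bound is lossless since
   [|M| <= q]. *)
move=> delta d0; have eps0 : 0 < delta / 12 by lra.
have [Q [S [B main]]] := ER_centered_norm r_ge3 eps0.
have powE n : n%:R `^ (r%:R / 2) = Num.sqrt n%:R ^+ r :> R.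
  by rewrite mulrC powRrM powR12_sqrt // powR_mulrn // sqrtr_ge0.
apply/cvgrPdist_le => e e0; near=> n.
have n1 : 1 <= n%:R :> R by near: n; exact: nbhs_infty_ger.
have nr : r%:R <= n%:R :> R by near: n; exact: nbhs_infty_ger.
have nd : 2 * r%:R ^+ 2 / delta <= n%:R by near: n; exact: nbhs_infty_ger.
have nB : B / e <= n%:R by near: n; exact: nbhs_infty_ger.
have nS : S ^+ 2 <= n%:R by near: n; exact: nbhs_infty_ger.
(* The only place where the growth of [p n * n ^ (r / 2)] enters. *)
have qQ : Q <= p n * n%:R `^ (r%:R / 2) by near: n; move/cvgryPge: p_large; apply.
rewrite powE in qQ *.
set s := Num.sqrt n%:R in qQ *.
have s2 : s ^+ 2 = n%:R by rewrite sqr_sqrtr.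
have s0 : 0 < s by rewrite sqrtr_gt0; lra.
have Ss : S <= s.
  apply: (le_trans (ler_norm _)); rewrite -sqrtr_sqr ler_wsqrtr //.
have n0 : (0 < n)%N by rewrite -(ltr0n R); lra.
have [F [F0 FE FA]] := main n (p n) s (p01 n) s2 Ss qQ.
have p0 : 0 <= p n by case/andP: (p01 n).
set A := (fun T : tensor R r n => _).
have P1 := ER_prob_le1 (p01 n) A.
suff P2 : 1 - ER_expect r (p n) F <= ER_prob (p n) A.
  rewrite ger0_norm ?subr_ge0 // lerBlDl -lerBlDr.
  apply: le_trans P2; rewrite lerD2l lerN2; apply: (le_trans FE).
  by rewrite ler_pdivrMr ?ltr0n // mulrC -ler_pdivrMr.
apply: ER_markov => // H HE FH; rewrite /A.
have := FA H HE FH.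
set T := adj_tensor R r H; set M := mean_tensor r n (p n) => TM.
have M1 : inj_norm M <= p n * s ^+ r by apply: inj_norm_mean_le.
have M2 : p n * s ^+ r * (1 - r%:R ^+ 2 / n%:R) <= inj_norm M.
  by apply: inj_norm_mean_ge => //; rewrite -(ler_nat R).
have t1 := inj_norm_leB T M n0.
have t2 := inj_norm_leBr T M n0.
set q := p n * s ^+ r in TM M1 M2 *.
have q0 : 0 <= q by rewrite mulr_ge0 // exprn_ge0 // ltW.
have rn2 : q * (r%:R ^+ 2 / n%:R) <= q * (delta / 2).
  rewrite ler_wpM2l // ler_pdivrMr ?ltr0n //.
  by move: nd; rewrite ler_pdivrMr //; lra.
rewrite ler_norml; apply/andP; split; lra.
Unshelve. all: by end_near.
Qed.
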